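(* Let $\{X_k\}$ be the explosive PAR(1) time series of the context (with $|\phi|>1$), and let $$\widehat\phi=\frac{\sum_{k=P+1}^{nP}X_kX_{k-P}}{\sum_{k=P+1}^{nP}(X_{k-P})^2}$$ be the least squares estimator of $\phi$ based on $X_0,\dots,X_{nP}$. Then: (1) Conditionally on $X_0+\zeta\ne0$, $\widehat\phi$ converges to $\phi$ almost surely as $n\to\infty$. (2) Assume that $\mathrm P[X_0+\zeta=0]=0$ and that the strong mixing condition $\lim_{n\to\infty}\alpha(n)=0$ is fulfilled. Then, as $n\to\infty$, the scaled error $\phi^n(\widehat\phi-\phi)$ converges in distribution to $$\frac{(\phi^2-1)\,\zeta^*}{\left(\sum_{r=1}^P\big(A_{r+1}^P\big)^{-2}\right)(X_0+\zeta)},$$ where $\zeta^*$ is a random variable independent of $(X_0,\zeta)$ whose distribution is that of $$\sum_{r=1}^P\sum_{k=0}^{P-1}\big(A_{r+1}^P\big)^{-1}A_{r-k+1}^r\sum_{j=1}^\infty\phi^{-j}u^*_{jP-r+k}.$$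
   Context: Model. All random variables are defined on a probability space $(\Omega,\mathcal F,\mathrm P)$. $P>0$ is an integer, $\{a_k\}_{k\in\mathbb Z}$ is a $P$-periodic sequence of real numbers ($a_{k+P}=a_k$), and $\{u_k\}_{k\in\mathbb Z}$ is a sequence of real centered random variables with finite second moments that is periodically distributed with period $P$: $(u_{P+s},\dots,u_{P+r})$ has the same law as $(u_s,\dots,u_r)$ for all integers $s\le r$. The $u_k$ are not assumed independent or uncorrelated. $X_0$ is a square integrable random variable, and $X_k=a_kX_{k-1}+u_k$ for $k=1,2,\dots$. Notation. For integers $s\le r$ (possibly $s\le 0$), $A_s^r=\prod_{j=s}^r a_j$, and $A_s^{s-1}=1$; $\phi=A_1^P=\prod_{r=1}^Pa_r$. It is assumed that $|\phi|>1$. $U_n^{(P)}=\sum_{s=1}^PA_{s+1}^P u_{nP+s}$, and $Z_n=\sum_{l=0}^n\phi^{-l-1}U_l^{(P)}$. The random variable $\zeta=\lim_{n\to\infty}Z_n$ is the limit of $Z_n$ almost surely and in quadratic mean (this limit exists). Mixing coefficient. $\alpha(n)=\sup|\mathrm P[A\cap B]-\mathrm P[A]\mathrm P[B]|$, the supremum being over all $k\in\mathbb N$ and all $A\in\mathcal F^k$, $B\in\mathcal F_{k+n}$, where $\mathcal F^k=\sigma(X_0,u_j:j\le k)$ and $\mathcal F_{k+n}=\sigma(u_j:j\ge k+n)$. Reversed sequence. The probability space is assumed rich enough to carry a sequence $\{u_k^*\}_{k\ge0}$, independent of $(X_0,\{u_k\})$, such that $(u_0^*,\dots,u_{nP-1}^*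 )$ has the same law as $(u_{nP},u_{nP-1},\dots,u_1)$ for every integer $n>1$. Convention. ''Conditionally on $X_0+\zeta\ne0$, the sequence converges almost surely'' means that convergence holds at almost every point of the event $\{X_0+\zeta\neq0\}$. *)

(* Defs.v *)
From HB Require Import structures.
From mathcomp Require Import all_boot all_order all_algebra.
From mathcomp Require Import all_classical all_reals all_analysis.

Set Implicit Arguments.
Unset Strict Implicit.
Unset Printing Implicit Defensive.

Import Order.TTheory GRing.Theory Num.Theory.
Import numFieldNormedType.Exports.

Local Open Scope classical_set_scope.
Local Open Scope ring_scope.

Section probability_notions.
Context {d : measure_display} {T : measurableType d} {R : realType}.
Variable P : probability T R.

(* Equality of the laws of two random elements of a measurable space.  For
   random vectors, rT is n.-tuple R with its product sigma-algebra. *)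
Definition same_law {d' : measure_display} {rT : measurableType d'}
    (f g : T -> rT) : Prop :=
  forall B : set rT, measurable B -> P (f @^-1` B) = P (g @^-1` B).

Definition sigma_rv (F : set (T -> R)) : set (set T) :=
  <<s \bigcup_(f in F) preimage_set_system [set: T] f measurable >>.

Definition indep_sigma (F G : set (set T)) : Prop :=
  forall A B, F A -> G B -> P (A `&` B) = (P A * P B)%E.

(* Weak convergence of the laws, tested on bounded continuous functions. *)
Definition cvg_in_distribution (Y : nat -> T -> R) (L : T -> R) : Prop :=
  forall f : R -> R, continuous f -> (exists M : R, forall x, `|f x| <= M) ->
    ('E_P[f \o Y n] @[n --> \oo] --> 'E_P[f \o L])%E.

End probability_notions.

Section coefficients.
Context {R : realType}.
Variables (a : int -> R) (p : nat).

(* prod_{j=s}^r a_j, equal to 1 when r < s; s and r may be negative. *)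
Definition Aprod (s r : int) : R :=
  if s <= r then \prod_(i < (absz (r - s)).+1) a (s + i%:Z) else 1.

Definition phi : R := Aprod 1 p%:Z.

End coefficients.

Section par_model.
Context {d : measure_display} {T : measurableType d} {R : realType}.
Context {P : probability T R}.
Variables (a : int -> R) (p : nat).

Definition periodically_distributed (u : int -> {RV P >-> R}) : Prop :=
  forall (s : int) (n : nat),
    same_law P (fun w => [tuple u (p%:Z + s + i%:Z) w | i < n.+1])
               (fun w => [tuple u (s + i%:Z) w | i < n.+1]).

Definition UP (u : int -> {RV P >-> R}) (n : nat) (w : T) : R :=
  \sum_(1 <= s < p.+1) Aprod a s.+1%:Z p%:Z * u (n * p + s)%N%:Z w.

Definition Z_ (u : int -> {RV P >-> R}) (n : nat) (w : T) : R :=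
  \sum_(0 <= l < n.+1) phi a p ^- l.+1 * UP u l w.

(* zeta is the limit of Z_ both almost surely and in quadratic mean. *)
Definition is_zeta (u : int -> {RV P >-> R}) (zeta : {RV P >-> R}) : Prop :=
  {ae P, forall w, Z_ u n w @[n --> \oo] --> zeta w} /\
  ('E_P[fun w => ((Z_ u n w - zeta w) ^+ 2)%R] @[n --> \oo] --> 0)%E.

(* sigma(X_0, u_j : j <= k) *)
Definition past (X0 : {RV P >-> R}) (u : int -> {RV P >-> R}) (k : int) :
    set (set T) :=
  sigma_rv ((X0 : T -> R) |` [set (u j : T -> R) | j in [set j | j <= k]]).

(* sigma(u_j : j >= k) *)
Definition future (u : int -> {RV P >-> R}) (k : int) : set (set T) :=
  sigma_rv [set (u j : T -> R) | j in [set j | k <= j]].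

Definition alpha_mixing (X0 : {RV P >-> R}) (u : int -> {RV P >-> R})
    (n : nat) : \bar R :=
  ereal_sup [set x | exists (k : nat) (A B : set T),
    [/\ past X0 u k%:Z A, future u (k + n)%N%:Z B &
        x = (`|P (A `&` B) - P A * P B|)%E]].

(* The quotient is 0 where the denominator vanishes (x / 0 = 0). *)
Definition phihat (X : nat -> {RV P >-> R}) (n : nat) (w : T) : R :=
  (\sum_(p.+1 <= k < (n * p).+1) X k w * X (k - p)%N w) /
  (\sum_(p.+1 <= k < (n * p).+1) (X (k - p)%N w) ^+ 2).

Definition is_reversed (X0 : {RV P >-> R}) (u : int -> {RV P >-> R})
    (ustar : nat -> {RV P >-> R}) : Prop :=
  indep_sigma P (sigma_rv [set (ustar k : T -> R) | k in [set: nat]])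
    (sigma_rv ((X0 : T -> R) |` [set (u j : T -> R) | j in [set: int]])) /\
  forall n : nat, (1 < n)%N ->
    same_law P (fun w => [tuple ustar i w | i < n * p])
               (fun w => [tuple u ((n * p)%N%:Z - i%:Z) w | i < n * p]).

(* The inner series is the pointwise limit of its partial sums; on the null
   event where it diverges, limn returns a default value.  The index
   j * p - r + k is nonnegative since 1 <= j and r <= p. *)
Definition reversed_series (ustar : nat -> {RV P >-> R}) (w : T) : R :=
  \sum_(1 <= r < p.+1) \sum_(0 <= k < p)
    (Aprod a r.+1%:Z p%:Z)^-1 * Aprod a (r%:Z - k%:Z + 1) r%:Z *
    limn (fun m => \sum_(1 <= j < m.+1)
      phi a p ^- j * ustar (j * p - r + k)%N w).

Definition is_zetastar (X0 zeta : {RV P >-> R}) (ustar : nat -> {RV P >-> R})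
    (zetastar : {RV P >-> R}) : Prop :=
  indep_sigma P (sigma_rv [set (zetastar : T -> R)])
    (sigma_rv [set (X0 : T -> R); (zeta : T -> R)]) /\
  same_law P (zetastar : T -> R) (reversed_series ustar).

Definition limit_variable (X0 zeta zetastar : {RV P >-> R}) (w : T) : R :=
  (phi a p ^+ 2 - 1) * zetastar w /
  ((\sum_(1 <= r < p.+1) Aprod a r.+1%:Z p%:Z ^- 2) * (X0 w + zeta w)).

End par_model.

(* Main.v *)
Require Import Defs.
From HB Require Import structures.
From mathcomp Require Import all_boot all_order all_algebra.
From mathcomp Require Import all_classical all_reals all_analysis.
From mathcomp Require Import measurable_realfun ring lra zify.
Import Order.TTheory GRing.Theory Num.Theory.
Import numFieldNormedType.Exports.
Local Open Scope classical_set_scope.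
Local Open Scope ring_scope.

Set Implicit Arguments.
Unset Strict Implicit.
Unset Printing Implicit Defensive.

(** Write [W = X_0 + zeta] and [b_r = 1 / A_{r+1}^P], so that [A_1^r = phi * b_r].

    Along a trajectory, [X_{mP+r} / phi^{m+1}] converges to [W * b_r]: at the
    multiples of [P] this is the convergence of [Z_n], and the noise terms [u_k] in
    between are almost surely negligible because their absolute moments are bounded
    ([cvg_normalised], [ae_cvg_normalised]). With
    [V_k = X_{k+P} - phi * X_k], the error of the estimator based on [n + 1] periods
    is a quotient, with numerator [sum V_k X_k] and denominator [sum X_k ^ 2]. Once
    normalised, both are convolutions with geometric weights, and Toeplitz's lemma
    ([cvg_geometric_convolution]) gives the limit of the denominator and, as [V_k] is
    negligible before [X_k], the strong consistency ([cvg_least_squares]).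

    For the second part, replacing [X_{mP+r} / phi^{m+1}] by its limit linearises the
    scaled error into [c * T_n / W], where [T_n] is a geometrically weighted sum of the
    last [V_k] and [c = (phi^2 - 1) / sum b_r^2]. The remainder is at most
    [A_n * B_n], with [A_n] vanishing almost surely and [B_n] bounded in mean
    ([least_squares_linearisation], [dominating_mean]); such a remainder does not
    affect limits in law ([asymptotic_equivalence]). The same bound allows [T_n] to be
    truncated to the last half of the periods.

    Read backwards, the truncated sum is a function of the reversed sequence, namely a
    partial sum of the series defining [zetastar]; hence [E g(T_n)] tends to
    [E g(zetastar)] ([cvg_linear_error_law]). Moreover [T_n] depends on late noise terms
    only, while [W] is approximated by [X_0 + Z_M], which belongs to the past; strong
    mixing makes [T_n] and [W] asymptotically independent
    ([mixing_asymptotic_independence]). The bridge from events to expectations is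
    [covariance_le], which approximates variables with values in the unit interval by
    averages of indicators of their level sets. Finally [E g(T_n) k(1 / W)] tends to
    [E g(zetastar) k(1 / W)] for all continuous [g] and [k], which is enough for
    the convergence of [E h(T_n / W)] by a partition of unity ([cvg_law_product]). *)

(** * Real sequences and continuous functions *)

(** Uniform continuity on a segment, in a form where only one of the two points
    has to lie in the segment. *)
Lemma continuous_unif_segment (R : realType) (f : R -> R) (K e : R) :
  continuous f -> 0 < e ->
  exists2 d : R, 0 < d &
    forall x y, `|x| <= K -> `|x - y| <= d -> `|f x - f y| <= e.
Proof.
move=> cf e0.
have /compact_near_coveringP ncov := @segment_compact R (- K) K.
have [] := ncov _ 0^'+
  (fun d x => forall y, `|x - y| <= d -> `|f x - f y| <= e) _.
  move=> x _.
  have /cvgrPdist_le/(_ (e / 2)) := cf x.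
  rewrite divr_gt0// => /(_ isT)/nbhs_ballP[r /= r0 Hr].
  exists (ball x (r / 2), [set d | d < r / 2]) => /=.
    split; first by apply: nbhsx_ballx; rewrite divr_gt0.
    by apply: nbhs_right_lt; rewrite divr_gt0.
  move=> [x' d] /= [xx' dr] y x'y.
  have h1 : `|f x - f x'| <= e / 2.
    by apply: Hr; apply: le_ball xx'; lra.
  have h2 : `|f x - f y| <= e / 2.
    apply: Hr; rewrite /ball/=.
    rewrite /ball/= in xx'.
    rewrite (_ : x - y = (x - x') + (x' - y)); last by ring.
    by rewrite (le_lt_trans (ler_normD _ _))//; lra.
  rewrite (_ : f x' - f y = (f x - f y) - (f x - f x')); last by ring.
  by rewrite (le_trans (ler_normB _ _))//; lra.
move=> r /= r0 Hr.
exists (r / 2); first by rewrite divr_gt0.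
move=> x y xK xy; apply: (Hr (r / 2)) xy => //=.
- by rewrite sub0r normrN gtr0_norm ?divr_gt0//; lra.
- by rewrite divr_gt0.
- by rewrite in_itv/= -ler_norml.
Qed.

Lemma cvg_sumr (R : realType) I (s : seq I) (u : I -> R^nat) (l : I -> R) :
  (forall i, u i n @[n --> \oo] --> l i) ->
  (\sum_(i <- s) u i n) @[n --> \oo] --> \sum_(i <- s) l i.
Proof.
move=> ul; elim: s => [|i s IH].
  by rewrite big_nil; under eq_cvg do rewrite big_nil; exact: cvg_cst.
by rewrite big_cons; under eq_cvg do rewrite big_cons; exact: cvgD.
Qed.

Lemma cvg_linear_recurrence0 (R : realType) (r : R) (s y : R^nat) :
  `|r| < 1 -> (forall n, s n.+1 = r * s n + y n) ->
  y n @[n --> \oo] --> 0 -> s n @[n --> \oo] --> 0.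
Proof.
move=> r1 sS y0; apply/cvgr0Pnorm_le => e e0.
have er : 0 < e / 2 * (1 - `|r|) by rewrite mulr_gt0 ?subr_gt0// divr_gt0.
have /cvgr0Pnorm_le/(_ _ er)[N _ HN] := y0.
have bound k : `|s (N + k)%N| <= `|r| ^+ k * `|s N| + e / 2.
  elim: k => [|k IH]; first by rewrite addn0 expr0 mul1r lerDl; lra.
  rewrite addnS sS (le_trans (ler_normD _ _))// normrM exprS.
  have := HN (N + k)%N (leq_addr _ _) => /= hy.
  have : `|r| * `|s (N + k)%N| <= `|r| * (`|r| ^+ k * `|s N| + e / 2).
    by rewrite ler_wpM2l.
  by nra.
have rk : `|r| ^+ k * `|s N| @[k --> \oo] --> 0.
  rewrite -[X in _ --> X](mul0r `|s N|); apply: cvgMr_tmp.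
  by apply: cvg_expr; rewrite normr_id.
have e20 : 0 < e / 2 by rewrite divr_gt0.
have /cvgr0Pnorm_le/(_ _ e20)[M _ HM] := rk.
exists (N + M)%N => //= n /= nNM.
have -> : n = (N + (n - N))%N by lia.
rewrite (le_trans (bound _))//.
have := HM (n - N)%N; rewrite /= ger0_norm; last by rewrite mulr_ge0// exprn_ge0.
by move=> /(_ _)h; have {}h := h ltac:(lia); lra.
Qed.

Lemma sum_geometric_le (R : realType) (r : R) (n : nat) : 0 <= r < 1 ->
  \sum_(0 <= k < n) r ^+ k <= (1 - r)^-1.
Proof.
move=> /andP[r0 r1]; have r1' : 0 < 1 - r by rewrite subr_gt0.
rewrite -[leRHS]mul1r ler_pdivlMr// mulrC big_mkord.
rewrite -[1 - r]opprB mulNr -subrX1 opprB.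
by have := exprn_ge0 n r0; lra.
Qed.

(** Toeplitz's lemma for geometric weights. *)
Lemma cvg_geometric_convolution (R : realType) (r l : R) (z : R^nat) :
  `|r| < 1 -> z n @[n --> \oo] --> l ->
  (\sum_(0 <= m < n) r ^+ (n - m) * z m) @[n --> \oo] --> r / (1 - r) * l.
Proof.
move=> r1 zl; set s := fun n => _; set c := r / (1 - r) * l.
have r1' : 1 - r != 0.
  by rewrite subr_eq0; apply: contraTN r1 => /eqP <-; rewrite normr1 ltxx.
have sS n : s n.+1 = r * (s n + z n).
  rewrite /s big_nat_recr//= subSnn expr1 mulrDr; congr (_ + _).
  rewrite big_distrr/=; apply: eq_big_nat => m /andP[_ mn].
  by rewrite subSn 1?ltnW// exprS mulrA.
have : (s n - c) @[n --> \oo] --> 0.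
  apply: (@cvg_linear_recurrence0 _ r _ (fun n => r * (z n - l))) => //.
    by move=> n; rewrite sS /c; field.
  rewrite -[X in _ --> X](mulr0 r); apply: cvgMl_tmp.
  by rewrite -(subrr l); apply: cvgB => //; exact: cvg_cst.
move=> h; have : (s n - c + c) @[n --> \oo] --> 0 + c.
  by apply: cvgD => //; exact: cvg_cst.
by rewrite add0r; under eq_cvg do rewrite subrK.
Qed.

(** For [0 < e], the continuous function equal to 0 up to [c], to 1 from [c + e] on,
    and affine in between. *)
Definition ramp (R : realType) (c e q : R) : R :=
  Num.max 0 (Num.min 1 ((q - c) / e)).

Lemma continuous_ramp (R : realType) (c e : R) : continuous (ramp c e).
Proof.
move=> q; apply: (@continuous_max _ _ (cst 0 : R -> R^o)
  ((cst 1 : R -> R^o) \min (fun x => (x - c) / e))).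
  exact: cst_continuous.
apply: (@continuous_min _ _ (cst 1 : R -> R^o) (fun x => (x - c) / e)).
  exact: cst_continuous.
by apply: cvgMr_tmp; apply: cvgB; [exact: cvg_id|exact: cvg_cst].
Qed.

Lemma ramp_ge0 (R : realType) (c e q : R) : 0 <= ramp c e q.
Proof. by rewrite /ramp le_max lexx. Qed.

Lemma ramp_le1 (R : realType) (c e q : R) : ramp c e q <= 1.
Proof. by rewrite /ramp ge_max ler01 ge_min lexx. Qed.

Lemma ramp1 (R : realType) (c e q : R) : 0 < e -> c + e <= q -> ramp c e q = 1.
Proof.
move=> e0 ceq; rewrite /ramp min_l; first by rewrite max_r.
by rewrite ler_pdivlMr// mul1r; lra.
Qed.

Lemma ramp0 (R : realType) (c e q : R) : 0 < e -> q <= c -> ramp c e q = 0.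
Proof.
move=> e0 qc; rewrite /ramp max_l// ge_min; apply/orP; right.
by rewrite ler_pdivrMr// mul0r; lra.
Qed.

Lemma ramp_mono (R : realType) (c c' e q : R) :
  0 < e -> c <= c' -> ramp c' e q <= ramp c e q.
Proof.
move=> e0 cc'; apply: le_max2 => //; apply: le_min2 => //.
by rewrite ler_pM2r ?invr_gt0//; lra.
Qed.

(** A continuous partition of unity over [[-K, K]] with small supports. *)
Lemma partition_of_unity (R : realType) (K e : R) : 0 <= K -> 0 < e ->
  exists (N : nat) (chi : nat -> R -> R) (c : nat -> R),
  [/\ forall i, continuous (chi i),
      forall i q, 0 <= chi i q <= 1,
      forall q, \sum_(0 <= i < N) chi i q <= 1,
      forall q, `|q| <= K -> \sum_(0 <= i < N) chi i q = 1 &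
      forall i q, chi i q != 0 -> `|q - c i| <= e].
Proof.
move=> K0 e0; pose e' := e / 2; have e'0 : 0 < e' by rewrite divr_gt0.
pose c i : R := - K - e' + i%:R * e'.
pose N := (Num.truncn ((2 * K + e') / e')).+1.
have cN : K <= c N.
  have : (2 * K + e') / e' < N%:R by exact: Num.Theory.truncnS_gt.
  by rewrite ltr_pdivrMr// /c => h; lra.
pose chi i q := ramp (c i) e' q - ramp (c i.+1) e' q.
have cS i : c i.+1 = c i + e' by rewrite /c -natr1; ring.
have tele q : \sum_(0 <= i < N) chi i q = ramp (c 0%N) e' q - ramp (c N) e' q.
  rewrite -opprB -(telescope_sumr (fun i => ramp (c i) e' q))// -sumrN.
  by apply: eq_bigr => i _; rewrite opprB.
(* The functions [chi i] are tent-shaped; their sum telescopes. *)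
exists N, chi, c; split.
- by move=> i q; apply: cvgB; exact: continuous_ramp.
- move=> i q; rewrite /chi subr_ge0 ramp_mono ?cS ?lerDl ?(ltW e'0)//=.
  by have := ramp_ge0 (c i + e') e' q; have := ramp_le1 (c i) e' q; lra.
- by move=> q; rewrite tele; have := ramp_ge0 (c N) e' q;
     have := ramp_le1 (c 0%N) e' q; lra.
- move=> q; rewrite ler_norml => /andP[Kq qK]; rewrite tele ramp1//.
    by rewrite ramp0 ?subr0//; exact: le_trans cN.
  by rewrite /c mul0r; lra.
- move=> i q; apply: contraNle => h; rewrite /chi.
  have [qc|cq] := leP q (c i).
    by rewrite !ramp0 ?subrr// cS; lra.
  rewrite ger0_norm in h; last by lra.
  have -> : ramp (c i) e' q = 1 by apply: ramp1 => //; rewrite /e' in h *; lra.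
  by rewrite ramp1 ?subrr// cS; rewrite /e' in h *; lra.
Qed.

(** On bounded sets, [h (t * q)] is approximated by finite sums of products of a
    function of [t] and a function of [q]. *)
Lemma product_approximation (R : realType) (h : R -> R) (K1 K2 e : R) :
  continuous h -> (forall x, 0 <= h x <= 1) -> 0 < K1 -> 0 <= K2 -> 0 < e ->
  exists (N : nat) (chi : nat -> R -> R) (c : nat -> R),
  [/\ forall i, continuous (chi i),
      forall i q, 0 <= chi i q <= 1,
      forall t q, 0 <= \sum_(0 <= i < N) h (t * c i) * chi i q <= 1 &
      forall t q, `|t| <= K1 -> `|q| <= K2 ->
        `|h (t * q) - \sum_(0 <= i < N) h (t * c i) * chi i q| <= e].
Proof.
move=> ch h01 K10 K20 e0.
have [d d0 Hd] := @continuous_unif_segment _ h (K1 * K2) _ ch e0.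
have dK : 0 < d / K1 by rewrite divr_gt0.
have [N [chi [c [cchi chi01 sum1 sumE supp]]]] := @partition_of_unity R K2 _ K20 dK.
exists N, chi, c; split => //.
- move=> t q; apply/andP; split.
    apply: sumr_ge0 => i _; rewrite mulr_ge0//; first by case/andP: (h01 (t * c i)).
    by case/andP: (chi01 i q).
  rewrite (le_trans _ (sum1 q))//; apply: ler_sum => i _.
  case/andP: (chi01 i q) => ? ?; case/andP: (h01 (t * c i)) => ? ?.
  by rewrite ler_piMl.
- move=> t q tK qK.
  rewrite -[h (t * q)]mulr1 -(sumE q)// big_distrr/= -sumrB.
  rewrite (le_trans (ler_norm_sum _ _ _))//.
  rewrite -[leRHS]mulr1 -(sumE q)// big_distrr/=; apply: ler_sum => i _.
  rewrite -mulrBl normrM; case/andP: (chi01 i q) => ? ?.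
  rewrite (@ger0_norm _ (chi i q))//.
  have [->|/supp qc] := eqVneq (chi i q) 0; first by rewrite !mulr0.
  rewrite ler_wpM2r//; apply: Hd; first by rewrite normrM ler_pM.
  rewrite -mulrBr normrM (le_trans (ler_pM _ _ tK qc))//.
  by rewrite mulrC divfK// gt_eqF.
Qed.

(** * Expectations of bounded random variables *)

Section bounded_expectation.
Context d (T : measurableType d) (R : realType) (P : probability T R).
Implicit Types f g X Y : T -> R.

Lemma integrable_bounded f (M : R) : measurable_fun setT f ->
  (forall w, `|f w| <= M) -> P.-integrable setT (EFin \o f).
Proof.
move=> mf fM; apply: measurable_bounded_integrable => //.
  by rewrite (@le_lt_trans _ _ 1%E) ?probability_le1// ltry.
exists M; split; first exact: num_real.
by move=> x Mx w _ /=; rewrite (le_trans (fM w))// ltW.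
Qed.

Lemma integrable_unit f : measurable_fun setT f ->
  (forall w, 0 <= f w <= 1) -> P.-integrable setT (EFin \o f).
Proof.
move=> mf f01; apply: (@integrable_bounded _ 1) => // w.
by case/andP: (f01 w) => ? ?; rewrite ger0_norm.
Qed.

Lemma expectation_Rintegral f : P.-integrable setT (EFin \o f) ->
  'E_P[f]%E = (\int[P]_w f w)%:E.
Proof. by move=> If; rewrite unlock /Rintegral fineK// integrable_fin_num. Qed.

Lemma Rintegral_probability (A : set T) : measurable A ->
  \int[P]_w (\1_A w) = fine (P A).
Proof. by move=> mA; rewrite /Rintegral integral_indic// setIT. Qed.

Lemma le_dist_Rintegral f g h : P.-integrable setT (EFin \o f) ->
  P.-integrable setT (EFin \o g) -> P.-integrable setT (EFin \o h) ->
  (forall w, `|f w - g w| <= h w) ->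
  `|\int[P]_w f w - \int[P]_w g w| <= \int[P]_w h w.
Proof.
move=> If Ig Ih fgh.
have Ifg : P.-integrable setT (EFin \o (fun w => f w - g w)).
  by apply: (eq_integrable _ _ (fun w => (f w)%:E - (g w)%:E)%E) => //;
     exact: integrableB.
rewrite -RintegralB// (le_trans (le_normr_Rintegral _ _))//.
apply: le_Rintegral => //.
by apply: (eq_integrable _ _ (fun w => `|(f w - g w)%:E|)%E) => //;
   exact: integrable_abse.
Qed.

Lemma Rintegral_sum I (s : seq I) (h : I -> T -> R) :
  (forall i, P.-integrable setT (EFin \o h i)) ->
  \int[P]_w (\sum_(i <- s) h i w) = \sum_(i <- s) \int[P]_w h i w.
Proof.
move=> Ih; elim: s => [|i s IH].
  under eq_Rintegral do rewrite big_nil.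
  by rewrite Rintegral_cst// mul0r big_nil.
under eq_Rintegral do rewrite big_cons.
rewrite RintegralD//; [by rewrite IH big_cons|].
have := @integrable_sum _ _ _ P _ measurableT I s xpredT
  (fun i w => (h i w)%:E) (fun i _ => Ih i).
by apply: eq_integrable => // w _ /=; rewrite sumEFin.
Qed.

Lemma bounded_convergence (f_ : nat -> T -> R) f (M : R) :
  (forall n, measurable_fun setT (f_ n)) -> measurable_fun setT f ->
  (forall n w, `|f_ n w| <= M) ->
  {ae P, forall w, f_ n w @[n --> \oo] --> f w} ->
  \int[P]_w f_ n w @[n --> \oo] --> \int[P]_w f w.
Proof.
move=> mf_ mf fM f_f.
have [] := @dominated_convergence _ _ _ P setT measurableT
  (fun n w => (f_ n w)%:E) (EFin \o f) (cst M%:E).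
- by move=> n; exact/measurable_EFinP.
- exact/measurable_EFinP.
- by apply: filterS f_f => w h _; apply: (cvg_EFin _ h); exact: nearW.
- by apply: (@integrable_bounded (cst M) `|M|) => //.
- by apply: aeW => w n _; rewrite lee_fin.
move=> If _ h; apply: fine_cvg.
by rewrite /Rintegral fineK//; exact: integrable_fin_num.
Qed.

Lemma measurable_ltr_indic (X : T -> R) (K : R) : measurable_fun setT X ->
  measurable [set w | K < X w].
Proof.
move=> mX; rewrite [X in measurable X](_ : _ = X @^-1` `]K, +oo[).
  by rewrite -[X in measurable X]setTI; exact: mX.
by apply/seteqP; split => w /=; rewrite in_itv/= andbT.
Qed.

Lemma measurable_ler_indic (X : T -> R) (K : R) : measurable_fun setT X ->
  measurable [set w | K <= X w].
Proof.
move=> mX; rewrite [X in measurable X](_ : _ = X @^-1` `[K, +oo[).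
  by rewrite -[X in measurable X]setTI; exact: mX.
by apply/seteqP; split => w /=; rewrite in_itv/= andbT.
Qed.

Lemma Rintegral_unit_ge0 f : (forall w, 0 <= f w <= 1) -> 0 <= \int[P]_w f w.
Proof. by move=> f01; apply: Rintegral_ge0 => w _; case/andP: (f01 w). Qed.

Lemma Rintegral_unit_le1 f : measurable_fun setT f ->
  (forall w, 0 <= f w <= 1) -> \int[P]_w f w <= 1.
Proof.
move=> mf f01; have -> : 1 = \int[P]_w (cst 1 w) :> R.
  rewrite Rintegral_cst//. by rewrite [X in fine X]probability_setT mulr1.
apply: le_Rintegral => //; first exact: integrable_unit.
  by apply: (@integrable_bounded _ 1) => // w; rewrite normr1.
by move=> w _; case/andP: (f01 w).
Qed.

Lemma tail_le_of_integral_le X (K C : R) : measurable_fun setT X -> 0 < K ->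
  (forall w, 0 <= X w) -> (\int[P]_w (X w)%:E <= C%:E)%E ->
  \int[P]_w \1_[set w | K < X w] w <= C / K.
Proof.
move=> mX K0 X0 XC.
have mS := measurable_ltr_indic K mX.
rewrite Rintegral_probability//.
have h : (P [set w | (K < X w)%R] <= (C / K)%:E)%E.
  rewrite -[X in P X]setIT -integral_indic// mulrC EFinM.
  rewrite (@le_trans _ _ (K^-1%:E * \int[P]_w (X w)%:E)%E)//; last first.
    by rewrite lee_pmul2l// ?fin_numE// lte_fin invr_gt0.
  rewrite -ge0_integralZl_EFin//; last 3 first.
  - by move=> w _; rewrite lee_fin.
  - exact/measurable_EFinP.
  - by rewrite invr_ge0 ltW.
  apply: ge0_le_integral => //.
  - exact/measurable_EFinP/measurable_indic.
  - by apply/measurable_EFinP; apply: measurable_funM => //.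
  move=> w _; rewrite -EFinM lee_fin indicE.
  case: (boolP (w \in _)) => [|_].
    by rewrite inE/= => h; rewrite ler_pdivlMl// mulr1 ltW.
  by rewrite mulr_ge0// invr_ge0 ltW.
have Pfin : P [set w | (K < X w)%R] \is a fin_num by exact: fin_num_measure.
by rewrite -lee_fin fineK.
Qed.

Lemma tight1 X (e : R) : measurable_fun setT X -> 0 < e ->
  exists2 K : R, 0 < K & \int[P]_w \1_[set w | K < `|X w|] w <= e.
Proof.
move=> mX e0.
have mnX : measurable_fun setT (fun w => `|X w|) by exact: measurableT_comp.
have : \int[P]_w \1_[set w | n%:R < `|X w|] w @[n --> \oo] --> \int[P]_w cst 0 w.
  apply: (@bounded_convergence _ _ 1).
  - by move=> n; apply: measurable_indic; exact: measurable_ltr_indic.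
  - exact: measurable_cst.
  - by move=> n w; rewrite indicE; case: (_ \in _); rewrite ?normr1 ?normr0.
  apply: aeW => w /=; apply: cvg_near_cst; near=> n.
  rewrite indicE memNset//=; apply/negP; rewrite -leNgt ltW//.
  by near: n; exact: nbhs_infty_gtr.
rewrite Rintegral_cst// mul0r => /cvgr0Pnorm_le/(_ _ e0)[N _ HN].
exists N.+1%:R => //; have := HN N.+1 (leqnSn _); apply: le_trans.
exact: ler_norm.
Unshelve. all: by end_near. Qed.

End bounded_expectation.

Lemma measurable_inv (R : realType) : measurable_fun setT (fun x : R => x^-1).
Proof.
rewrite (_ : (fun x => _) = (fun x : R => x * (x ^+ 2) `^ (-1))).
  apply: measurable_funM => //.
  apply: (@measurableT_comp _ _ _ _ _ _ (fun x => x `^ (-1)) _ (fun x : R => x ^+ 2)).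
    exact: measurable_powR.
  exact: exprn_measurable.
apply/funext => x; rewrite powR_inv1 ?sqr_ge0//.
have [->|x0] := eqVneq x 0; first by rewrite invr0 mul0r.
by rewrite expr2 invfM mulrA divff ?mul1r.
Qed.

Lemma measurable_funV d (T : measurableType d) (R : realType) (f : T -> R) :
  measurable_fun setT f -> measurable_fun setT (fun w => (f w)^-1).
Proof.
by move=> mf; apply: (@measurableT_comp _ _ _ _ _ _ (fun x : R => x^-1));
  [exact: measurable_inv|].
Qed.

Lemma measurable_sumr d (T : measurableType d) (R : realType) I (s : seq I)
    (h : I -> T -> R) : (forall i, measurable_fun setT (h i)) ->
  measurable_fun setT (fun w => \sum_(i <- s) h i w).
Proof.
move=> mh; elim: s => [|i s IH].
  by under eq_fun do rewrite big_nil; exact: measurable_cst.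
by under eq_fun do rewrite big_cons; exact: measurable_funD.
Qed.

Lemma measurable_continuous_comp d (T : measurableType d) (R : realType)
    (f : R -> R) (X : T -> R) :
  continuous f -> measurable_fun setT X -> measurable_fun setT (fun w => f (X w)).
Proof.
by move=> cf mX; apply: (@measurableT_comp _ _ _ _ _ _ f);
  [exact: continuous_measurable_fun|].
Qed.

(** * Approximate independence, laws and limits in distribution *)

(** The staircase approximation, with [N] steps, of the identity of [[0, 1]]. *)
Definition staircase (R : realType) (N : nat) (x : R) : R :=
  N%:R^-1 * \sum_(0 <= i < N) (i.+1%:R / N%:R <= x)%R%:R.

Lemma sum_leq_minn (N k : nat) : (\sum_(0 <= i < N) (i < k))%N = minn N k.
Proof.
elim: N => [|N IH]; first by rewrite big_nil min0n.
by rewrite big_nat_recr//= IH; case: (ltnP N k) => /=; lia.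
Qed.

Lemma staircase_bounds (R : realType) (N : nat) (x : R) :
  (0 < N)%N -> 0 <= x <= 1 -> 0 <= x - staircase N x <= N%:R^-1.
Proof.
move=> N0 /andP[x0 x1]; have N0' : 0 < N%:R :> R by rewrite ltr0n.
have Nx : 0 <= N%:R * x by rewrite mulr_ge0// ltW.
have -> : staircase N x = N%:R^-1 * (Num.truncn (N%:R * x))%:R.
  rewrite /staircase; congr (_ * _).
  have <- : minn N (Num.truncn (N%:R * x)) = Num.truncn (N%:R * x).
    apply/minn_idPr; rewrite -(@ler_nat R).
    by rewrite (@le_trans _ _ (N%:R * x))// ?Num.Theory.truncn_le// ler_piMr// ltW.
  rewrite -sum_leq_minn natr_sum; apply: eq_bigr => i _.
  by rewrite Num.Theory.truncn_ge_nat// ler_pdivrMr// mulrC.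
have /andP[h1 h2] := Num.Theory.truncn_itv Nx.
set k := (Num.truncn _)%:R in h1 h2 *.
have -> : x - N%:R^-1 * k = N%:R^-1 * (N%:R * x - k).
  by rewrite mulrBr mulKf// gt_eqF.
rewrite mulr_ge0 ?invr_ge0 ?subr_ge0 ?(ltW N0')//=.
rewrite -[leRHS]mulr1 ler_pM2l ?invr_gt0// lerBlDl.
by rewrite -natr1 -/k in h2; lra.
Qed.

Lemma cvg_staircase (R : realType) (x : R) : 0 <= x <= 1 ->
  staircase N x @[N --> \oo] --> x.
Proof.
move=> x01; apply/cvgrPdist_le => e e0; near=> N.
have N0 : (0 < N)%N by near: N; exact: nbhs_infty_gt.
have /andP[h1 h2] := staircase_bounds N0 x01.
rewrite ger0_norm// (le_trans h2)// -[leRHS]invrK lef_pV2 ?posrE ?invr_gt0 ?ltr0n//.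
by near: N; exact: nbhs_infty_ger.
Unshelve. all: by end_near. Qed.

Lemma staircase_unit (R : realType) (N : nat) (x : R) : 0 <= staircase N x <= 1.
Proof.
rewrite /staircase; apply/andP; split.
  by rewrite mulr_ge0 ?invr_ge0// sumr_ge0.
case: N => [|N]; first by rewrite invr0 mul0r.
rewrite ler_pdivrMl// mulr1 -natr_sum ler_nat.
rewrite (@leq_trans (\sum_(0 <= i < N.+1) 1)%N)//.
  by apply: leq_sum => i _; case: (_ <= x).
by rewrite sum_nat_const_nat subn0 muln1.
Qed.

Section covariance.
Context d (T : measurableType d) (R : realType) (P : probability T R).
Implicit Types X Y : T -> R.

Lemma staircase_indic X N w : staircase N (X w) =
  N%:R^-1 * \sum_(0 <= i < N) \1_[set w | i.+1%:R / N%:R <= X w] w :> R.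
Proof.
congr (_ * _); apply: eq_bigr => i _; rewrite indicE; congr ((nat_of_bool _)%:R).
by apply/idP/idP; rewrite inE.
Qed.

Lemma measurable_staircase X N : measurable_fun setT X ->
  measurable_fun setT (fun w => staircase N (X w)).
Proof.
move=> mX; under eq_fun do rewrite staircase_indic.
apply: measurable_funM => //; apply: measurable_sumr => i.
by apply: measurable_indic; exact: measurable_ler_indic.
Qed.

(** If the level sets of [X] and of [Y] are independent up to [alpha], the covariance
    of [X] and [Y] is at most [alpha]; with [alpha = 0] this is the product rule. *)
Lemma covariance_le X Y (alpha : R) :
  measurable_fun setT X -> measurable_fun setT Y ->
  (forall w, 0 <= X w <= 1) -> (forall w, 0 <= Y w <= 1) ->
  (forall s t : R, `|fine (P ([set w | s <= X w] `&` [set w | t <= Y w])) -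
     fine (P [set w | s <= X w]) * fine (P [set w | t <= Y w])| <= alpha) ->
  `|\int[P]_w (X w * Y w) - (\int[P]_w X w) * (\int[P]_w Y w)| <= alpha.
Proof.
move=> mX mY X01 Y01 XY.
pose SX N w := staircase N (X w); pose SY N w := staircase N (Y w).
have mSX N : measurable_fun setT (SX N) by exact: measurable_staircase.
have mSY N : measurable_fun setT (SY N) by exact: measurable_staircase.
have normu (x : R) : 0 <= x <= 1 -> `|x| <= 1 by case/andP => ? ?; rewrite ger0_norm.
have limX : \int[P]_w SX N w @[N --> \oo] --> \int[P]_w X w.
  apply: (@bounded_convergence _ _ _ _ _ _ 1) => //.
    by move=> N w; apply/normu/staircase_unit.
  by apply: aeW => w; exact: cvg_staircase.
have limY : \int[P]_w SY N w @[N --> \oo] --> \int[P]_w Y w.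
  apply: (@bounded_convergence _ _ _ _ _ _ 1) => //.
    by move=> N w; apply/normu/staircase_unit.
  by apply: aeW => w; exact: cvg_staircase.
have limXY : \int[P]_w (SX N w * SY N w) @[N --> \oo] --> \int[P]_w (X w * Y w).
  apply: (@bounded_convergence _ _ _ _ _ _ 1) => //.
  - by move=> N; exact: measurable_funM.
  - exact: measurable_funM.
  - by move=> N w; rewrite normrM mulr_ile1//; exact/normu/staircase_unit.
  by apply: aeW => w; apply: cvgM; exact: cvg_staircase.
have lim : `|\int[P]_w (SX N w * SY N w) - (\int[P]_w SX N w) * (\int[P]_w SY N w)|
    @[N --> \oo] --> `|\int[P]_w (X w * Y w) - (\int[P]_w X w) * (\int[P]_w Y w)|.
  by apply: cvg_norm; apply: cvgB => //; exact: cvgM.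
rewrite -(cvg_lim _ lim)//; apply: limr_le; first exact: cvgP lim.
near=> N.
have N0 : (0 < N)%N by near: N; exact: nbhs_infty_gt.
have N0' : 0 < N%:R :> R by rewrite ltr0n.
pose A (i : nat) := [set w | i.+1%:R / N%:R <= X w].
pose B (i : nat) := [set w | i.+1%:R / N%:R <= Y w].
have mA i : measurable (A i) by exact: measurable_ler_indic.
have mB i : measurable (B i) by exact: measurable_ler_indic.
have intI (S : set T) : measurable S -> P.-integrable setT (EFin \o (\1_S : T -> R)).
  move=> mS; apply: integrable_unit; first exact: measurable_indic.
  by move=> w; rewrite indicE; case: (_ \in _); rewrite ?lexx ?ler01.
have intS (C : nat -> set T) : (forall i, measurable (C i)) ->
    P.-integrable setT (EFin \o (fun w => \sum_(0 <= i < N) \1_(C i) w : R)).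
  move=> mC; apply: (@integrable_bounded _ _ _ _ _ N%:R).
    by apply: measurable_sumr => i; exact: measurable_indic.
  move=> w; rewrite (le_trans (ler_norm_sum _ _ _))//.
  rewrite (@le_trans _ _ (\sum_(0 <= i < N) 1))//.
    by apply: ler_sum => i _; rewrite indicE; case: (_ \in _); rewrite ?normr1 ?normr0.
  by rewrite sumr_const_nat subn0.
have -> : \int[P]_w SX N w = N%:R^-1 * \sum_(0 <= i < N) fine (P (A i)).
  under eq_Rintegral do rewrite /SX staircase_indic.
  rewrite RintegralZl//; last exact: (intS A).
  rewrite Rintegral_sum; last by move=> i; exact: (intI _ (mA i)).
  by under eq_bigr => i _ do rewrite (Rintegral_probability _ (mA i)).
have -> : \int[P]_w SY N w = N%:R^-1 * \sum_(0 <= i < N) fine (P (B i)).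
  under eq_Rintegral do rewrite /SY staircase_indic.
  rewrite RintegralZl//; last exact: (intS B).
  rewrite Rintegral_sum; last by move=> i; exact: (intI _ (mB i)).
  by under eq_bigr => i _ do rewrite (Rintegral_probability _ (mB i)).
have -> : \int[P]_w (SX N w * SY N w) = N%:R^-1 * (N%:R^-1 *
    \sum_(0 <= i < N) \sum_(0 <= j < N) fine (P (A i `&` B j))).
  transitivity (\int[P]_w (N%:R^-1 * (N%:R^-1 *
    \sum_(0 <= i < N) \sum_(0 <= j < N) \1_(A i `&` B j) w))).
    apply: eq_Rintegral => w _; rewrite /SX /SY !staircase_indic.
    rewrite mulrACA -mulrA; congr (_ * (_ * _)).
    rewrite big_distrlr/=; apply: eq_bigr => i _; apply: eq_bigr => j _.
    by rewrite indicI.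
  have intAB i : P.-integrable setT
      (EFin \o (fun w => \sum_(0 <= j < N) \1_(A i `&` B j) w : R)).
    by apply: intS => j; exact: measurableI.
  have intABs : P.-integrable setT
     (EFin \o (fun w => \sum_(0 <= i < N) \sum_(0 <= j < N) \1_(A i `&` B j) w : R)).
    have := @integrable_sum _ _ _ P _ measurableT nat (index_iota 0 N) xpredT
      (fun i w => (\sum_(0 <= j < N) \1_(A i `&` B j) w)%:E) (fun i _ => intAB i).
    by apply: eq_integrable => // w _ /=; rewrite sumEFin.
  rewrite RintegralZl//; last first.
    have := integrableZl measurableT N%:R^-1 intABs.
    by apply: eq_integrable.
  rewrite RintegralZl// Rintegral_sum//; congr (_ * (_ * _)).
  apply: eq_bigr => i _; rewrite Rintegral_sum//; last first.
    by move=> j; apply: intI; exact: measurableI.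
  by apply: eq_bigr => j _; rewrite Rintegral_probability//; exact: measurableI.
rewrite mulrACA -[X in _ - X]mulrA -!mulrBr big_distrlr/= -sumrB.
rewrite mulrA normrM ger0_norm ?mulr_ge0 ?invr_ge0 ?(ltW N0')//.
rewrite (@le_trans _ _ (N%:R^-1 * N%:R^-1 *
   \sum_(0 <= i < N) \sum_(0 <= j < N) alpha))//; last first.
  rewrite !sumr_const_nat subn0 -[X in _ * X]mulr_natr -[alpha *+ N]mulr_natr.
  have -> : N%:R^-1 * N%:R^-1 * (alpha * N%:R * N%:R) = alpha.
    by field; rewrite gt_eqF.
  by [].
rewrite ler_wpM2l ?mulr_ge0 ?invr_ge0 ?(ltW N0')//.
rewrite (le_trans (ler_norm_sum _ _ _))//; apply: ler_sum => i _.
rewrite -sumrB (le_trans (ler_norm_sum _ _ _))//; apply: ler_sum => j _.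
exact: XY.
Unshelve. all: by end_near. Qed.

End covariance.

Section limits_in_law.
Context d (T : measurableType d) (R : realType) (P : probability T R).

(** A domination by a product of an almost surely vanishing factor and of a factor
    bounded in mean makes two sequences asymptotically equivalent in law. *)
Lemma asymptotic_equivalence (f : R -> R) (Y Y' A B : nat -> T -> R) (C : R) :
  continuous f -> (forall x, 0 <= f x <= 1) ->
  (forall n, measurable_fun setT (Y n)) -> (forall n, measurable_fun setT (Y' n)) ->
  (forall n, measurable_fun setT (B n)) -> (forall n w, 0 <= B n w) ->
  (forall n, (\int[P]_w (B n w)%:E <= C%:E)%E) ->
  {ae P, forall w, [/\ A n w @[n --> \oo] --> 0,
     exists c : R, forall n, `|Y' n w| <= c * B n w &
     \forall n \near \oo, `|Y n w - Y' n w| <= A n w * B n w]} ->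
  (\int[P]_w f (Y n w) - \int[P]_w f (Y' n w)) @[n --> \oo] --> 0.
Proof.
move=> cf f01 mY mY' mB B0 BC ae; apply/cvgr0Pnorm_le => e e0.
have C0 : 0 <= C.
  have := BC 0%N; rewrite -lee_fin; apply: le_trans.
  by apply: integral_ge0 => w _; rewrite lee_fin.
pose K := 2 * C / e + 1; have K0 : 0 < K.
  by rewrite /K ltr_wpDl// !mulr_ge0// invr_ge0 ltW.
(* Where [B n] is at most [K], dominated convergence applies; elsewhere Markov's
   inequality does. *)
pose D n w : R := \1_(~` [set w | K < B n w]) w * `|f (Y n w) - f (Y' n w)|.
have mf n : measurable_fun setT (fun w => f (Y n w)).
  exact: measurable_continuous_comp.
have mf' n : measurable_fun setT (fun w => f (Y' n w)).
  exact: measurable_continuous_comp.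
have dist01 x y : `|f x - f y| <= 1.
  by have /andP[? ?] := f01 x; have /andP[? ?] := f01 y; rewrite ler_norml; lra.
have mS n : measurable [set w | K < B n w] by exact: measurable_ltr_indic.
have mD n : measurable_fun setT (D n).
  apply: measurable_funM; first by apply: measurable_indic; exact: measurableC.
  by apply: measurableT_comp => //; exact: measurable_funB.
have D01 n w : 0 <= D n w <= 1.
  rewrite /D indicE; case: (_ \in _); rewrite ?mul1r ?mul0r ?lexx ?ler01//.
  by rewrite normr_ge0 dist01.
have limD : \int[P]_w D n w @[n --> \oo] --> 0.
  have -> : 0 = \int[P]_w (cst 0 w) :> R by rewrite Rintegral_cst// mul0r.
  apply: (@bounded_convergence _ _ _ _ _ _ 1) => //.
    by move=> n w; case/andP: (D01 n w) => ? ?; rewrite ger0_norm.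
  apply: filterS ae => w [A0 [c Y'c] YY'].
  apply/cvgr0Pnorm_le => r r0.
  have [q q0 Hq] := @continuous_unif_segment _ f (`|c| * K) _ cf r0.
  have qK : 0 < q / K by rewrite divr_gt0.
  have /cvgr0Pnorm_le/(_ _ qK) A0' := A0.
  near=> n; have /andP[Dn _] := D01 n w; rewrite ger0_norm//.
  rewrite /D indicE; case: (boolP (_ \in _)); last by rewrite mul0r ltW.
  rewrite inE /= => /negP; rewrite -leNgt => BK.
  rewrite mul1r distrC; apply: Hq.
    rewrite (le_trans (Y'c n))// (@le_trans _ _ (`|c| * B n w))//.
      by rewrite ler_wpM2r// ler_norm.
    by rewrite ler_wpM2l.
  rewrite distrC (@le_trans _ _ (A n w * B n w))//.
    by near: n.
  have An : A n w <= q / K by apply: le_trans (ler_norm _) _; near: n.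
  rewrite (@le_trans _ _ (q / K * B n w))// ?ler_wpM2r//.
  by rewrite mulrAC ler_pdivrMr// ler_wpM2l// ltW.
have e20 : 0 < e / 2 by rewrite divr_gt0.
have /cvgr0Pnorm_le/(_ _ e20)[N _ HN] := limD.
exists N => //= n Nn; have Dn := HN n Nn; rewrite /= in Dn.
have int1 (g : T -> R) : measurable_fun setT g -> (forall w, 0 <= g w <= 1) ->
  P.-integrable setT (EFin \o g) by exact: integrable_unit.
have intS : P.-integrable setT (EFin \o (\1_[set w | K < B n w] : T -> R)).
  apply: int1; first exact: measurable_indic.
  by move=> w; rewrite indicE; case: (_ \in _); rewrite ?lexx ?ler01.
rewrite (@le_trans _ _ (\int[P]_w (D n w + \1_[set w | K < B n w] w)))//.
  apply: le_dist_Rintegral; [exact: int1|exact: int1| |].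
  - apply: (@integrable_bounded _ _ _ _ _ 2).
      by apply: measurable_funD => //; exact: measurable_indic.
    move=> w; case/andP: (D01 n w) => ? ?; rewrite indicE.
    by case: (_ \in _) => /=; rewrite ?mulr1n ?mulr0n ger0_norm; lra.
  - move=> w; rewrite /D !indicE in_setC.
    case: (_ \in _) => /=; first by rewrite mul0r add0r.
    by rewrite mul1r addr0.
rewrite RintegralD//; last exact: int1.
have h1 : \int[P]_w D n w <= e / 2 by apply: le_trans Dn; exact: ler_norm.
have h2 : \int[P]_w \1_[set w | K < B n w] w <= C / K.
  exact: tail_le_of_integral_le.
have h3 : C / K <= e / 2.
  rewrite ler_pdivrMr// (_ : e / 2 * K = C + e / 2); first by lra.
  by rewrite /K; field; rewrite gt_eqF.
by lra.
Unshelve. all: by end_near. Qed.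

(** For a tight sequence [t_n], convergence of [E g(t_n) k(Q)] for all test functions
    [g] and [k] implies convergence of [E h(t_n Q)]. *)
Lemma cvg_law_product (h : R -> R) (t_ : nat -> T -> R) (t Q : T -> R) :
  continuous h -> (forall x, 0 <= h x <= 1) ->
  (forall n, measurable_fun setT (t_ n)) -> measurable_fun setT t ->
  measurable_fun setT Q ->
  (forall e : R, 0 < e -> exists2 K : R, 0 < K &
     forall n, \int[P]_w \1_[set w | K < `|t_ n w|] w <= e) ->
  (forall g k : R -> R, continuous g -> continuous k ->
     (forall x, 0 <= g x <= 1) -> (forall x, 0 <= k x <= 1) ->
     \int[P]_w (g (t_ n w) * k (Q w)) @[n --> \oo] -->
     \int[P]_w (g (t w) * k (Q w))) ->
  \int[P]_w h (t_ n w * Q w) @[n --> \oo] --> \int[P]_w h (t w * Q w).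
Proof.
move=> ch h01 mt_ mt mQ tight lim; apply/cvgrPdist_le => e e0.
have e8 : 0 < e / 8 by rewrite divr_gt0.
have [Ka Ka0 HKa] := tight _ e8.
have [Kb Kb0 HKb] := tight1 P mt e8.
have [K2 K20 HK2] := tight1 P mQ e8.
(* Up to three terms of size [e / 8], [h (t q)] may be replaced by a finite sum of
   products, uniformly in [n]. *)
pose K1 := Num.max Ka Kb.
have K10 : 0 < K1 by rewrite lt_max Ka0.
have [N [chi [c [cchi chi01 S01 approx]]]] :=
  product_approximation ch h01 K10 (ltW K20) e8.
pose Phi (s q : R) := \sum_(0 <= i < N) h (s * c i) * chi i q.
have chc i : continuous (fun s : R => h (s * c i)).
  move=> s; apply: (@continuous_comp _ _ _ (fun s : R => s * c i) h); last exact: ch.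
  by apply: cvgMr_tmp; exact: cvg_id.
have mterm (s : T -> R) i : measurable_fun setT s ->
    measurable_fun setT (fun w => h (s w * c i) * chi i (Q w)).
  move=> ms; apply: measurable_funM.
    exact: (measurable_continuous_comp (f := fun s => h (s * c i))).
  exact: measurable_continuous_comp.
have term01 (s q : R) i : 0 <= h (s * c i) * chi i q <= 1.
  have /andP[? ?] := h01 (s * c i); have /andP[? ?] := chi01 i q.
  by rewrite mulr_ge0//= mulr_ile1.
have int1 (g : T -> R) : measurable_fun setT g -> (forall w, 0 <= g w <= 1) ->
  P.-integrable setT (EFin \o g) by exact: integrable_unit.
have mPhi (s : T -> R) : measurable_fun setT s ->
    measurable_fun setT (fun w => Phi (s w) (Q w)).
  by move=> ms; apply: measurable_sumr => i; exact: mterm.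
have limPhi : \int[P]_w Phi (t_ n w) (Q w) @[n --> \oo] --> \int[P]_w Phi (t w) (Q w).
  have PhiE (s : T -> R) : measurable_fun setT s -> \int[P]_w Phi (s w) (Q w) =
      \sum_(0 <= i < N) \int[P]_w (h (s w * c i) * chi i (Q w)).
    by move=> ms; rewrite Rintegral_sum// => i; apply: int1 => //; exact: mterm.
  rewrite PhiE//; under eq_cvg do rewrite PhiE//.
  apply: cvg_sumr => i.
  exact: (lim (fun s => h (s * c i)) (chi i)).
have close (s : T -> R) (K : R) : measurable_fun setT s -> K <= K1 ->
    \int[P]_w \1_[set w | K < `|s w|] w <= e / 8 ->
    `|\int[P]_w h (s w * Q w) - \int[P]_w Phi (s w) (Q w)| <= e / 8 * 3.
  move=> ms KK1 tail.
  have mns : measurable_fun setT (fun w => `|s w|) by exact: measurableT_comp.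
  have mnQ : measurable_fun setT (fun w => `|Q w|) by exact: measurableT_comp.
  have mSs : measurable [set w | K < `|s w|] by exact: measurable_ltr_indic.
  have mSQ : measurable [set w | K2 < `|Q w|] by exact: measurable_ltr_indic.
  have int1S (S : set T) : measurable S -> P.-integrable setT (EFin \o (\1_S : T -> R)).
    move=> mS; apply: int1; first exact: measurable_indic.
    by move=> w; rewrite indicE; case: (_ \in _); rewrite ?lexx ?ler01.
  have intc : P.-integrable setT (EFin \o (cst (e / 8) : T -> R)).
    by apply: (@integrable_bounded _ _ _ _ _ `|e / 8|).
  have intcS : P.-integrable setT
      (EFin \o (fun w => cst (e / 8) w + \1_[set w | K < `|s w|] w : R)).
    apply: (@integrable_bounded _ _ _ _ _ (e / 8 + 1)).
      by apply: measurable_funD => //; exact: measurable_indic.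
    by move=> w; rewrite indicE; case: (_ \in _); rewrite /= ger0_norm; lra.
  rewrite (@le_trans _ _ (\int[P]_w (cst (e / 8) w + \1_[set w | K < `|s w|] w +
      \1_[set w | K2 < `|Q w|] w)))//.
    apply: le_dist_Rintegral.
    - apply: int1 => //; apply: measurable_continuous_comp => //.
      exact: measurable_funM.
    - by apply: int1; [exact: mPhi|move=> w; exact: S01].
    - apply: (@integrable_bounded _ _ _ _ _ (e / 8 + 2)).
        by apply: measurable_funD; [apply: measurable_funD => //|];
          exact: measurable_indic.
      move=> w; rewrite !indicE.
      by case: (_ \in _); case: (_ \in _); rewrite /= ger0_norm; lra.
    move=> w; rewrite !indicE /=.
    have le1 : `|h (s w * Q w) - Phi (s w) (Q w)| <= 1.
      have /andP[? ?] := h01 (s w * Q w).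
      by have /andP[] := S01 (s w) (Q w); rewrite -/(Phi _ _) ler_norml; lra.
    case: (boolP (_ \in _)) => [_|/negP]; first by case: (_ \in _) => /=; lra.
    rewrite inE/= => /negP; rewrite -leNgt => sK.
    case: (boolP (_ \in _)) => [_|/negP] /=; first by lra.
    rewrite inE/= => /negP; rewrite -leNgt => QK.
    by rewrite !addr0; apply: approx => //; exact: le_trans KK1.
  rewrite RintegralD//; last exact: int1S.
  rewrite RintegralD//; last exact: int1S.
  rewrite Rintegral_cst// [X in fine X]probability_setT mulr1.
  by lra.
have /cvgrPdist_le/(_ _ e8)[M _ HM] := limPhi.
exists M => //= n Mn; have := HM n Mn => /= h1.
have h2 := close _ _ (mt_ n) (_ : Ka <= K1) (HKa n).
have h3 := close _ _ mt (_ : Kb <= K1) HKb.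
have {}h2 := h2 ltac:(by rewrite le_max lexx).
have {}h3 := h3 ltac:(by rewrite le_max lexx orbT).
move: h1 h2 h3; rewrite !ler_norml; lra.
Qed.

End limits_in_law.

Section laws.
Context d (T : measurableType d) (R : realType) (P : probability T R).

Lemma same_law_integral d' (rT : measurableType d') (f1 f2 : T -> rT) (g : rT -> R) :
  measurable_fun setT f1 -> measurable_fun setT f2 -> same_law P f1 f2 ->
  measurable_fun setT g -> (forall y, 0 <= g y) ->
  (\int[P]_w (g (f1 w))%:E = \int[P]_w (g (f2 w))%:E)%E.
Proof.
move=> mf1 mf2 f12 mg g0.
have mg' : measurable_fun setT (EFin \o g) by exact/measurable_EFinP.
have push f : measurable_fun setT f ->
    (\int[P]_w (g (f w))%:E = \int[pushforward P f]_y (g y)%:E)%E.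
  move=> mf; rewrite (ge0_integral_pushforward mf)//.
  by move=> y _; rewrite lee_fin.
rewrite push// (push _ mf2).
apply: (@eq_measure_integral _ _ _ _ (pushforward P f2) (pushforward P f1)).
by move=> A mA _; exact: f12.
Qed.

Lemma same_law_Rintegral d' (rT : measurableType d') (f1 f2 : T -> rT) (g : rT -> R) :
  measurable_fun setT f1 -> measurable_fun setT f2 -> same_law P f1 f2 ->
  measurable_fun setT g -> (forall y, 0 <= g y) ->
  \int[P]_w g (f1 w) = \int[P]_w g (f2 w).
Proof.
move=> mf1 mf2 f12 mg g0; rewrite /Rintegral.
by rewrite (same_law_integral mf1 mf2 f12 mg g0).
Qed.

(** Geometric weights make a sequence bounded in mean almost surely summable. *)
Lemma ae_cvg_geometric_series (xi : nat -> T -> R) (r C : R) : 0 <= r < 1 ->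
  (forall n, measurable_fun setT (xi n)) ->
  (forall n, (\int[P]_w `|xi n w|%:E <= C%:E)%E) ->
  {ae P, forall w, cvgn (series (fun n => r ^+ n * `|xi n w|))}.
Proof.
move=> /andP[r0 r1] mxi xiC.
pose a n w := r ^+ n * `|xi n w|.
have a0 n w : 0 <= a n w by rewrite mulr_ge0// exprn_ge0.
have ma n : measurable_fun setT (a n).
  by apply: measurable_funM => //; exact: measurableT_comp.
have maE n : measurable_fun setT (EFin \o a n) by exact/measurable_EFinP.
have C0 : 0 <= C.
  have := xiC 0%N; rewrite -lee_fin; apply: le_trans.
  by apply: integral_ge0 => w _; rewrite lee_fin.
pose S w := (\sum_(0 <= n <oo) (a n w)%:E)%E.
have S0 w : (0 <= S w)%E by apply: nneseries_ge0 => n _ _; rewrite lee_fin.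
have mS : measurable_fun setT S.
  by apply: ge0_emeasurable_sum => [n w _ _|n _]; [rewrite lee_fin|exact: maE].
have intS : (\int[P]_w S w <= (C / (1 - r))%:E)%E.
  rewrite integral_nneseries//; last by move=> n w _; rewrite lee_fin.
  apply: lime_le.
    apply: is_cvg_nneseries => n _ _; apply: integral_ge0 => w _; rewrite lee_fin//.
  apply: nearW => n.
  rewrite (@le_trans _ _ (\sum_(0 <= k < n) (r ^+ k * C)%:E)%E)//.
    apply: lee_sum => k _; rewrite /a; under eq_integral do rewrite EFinM.
    rewrite ge0_integralZl_EFin//; last 2 first.
    - by apply/measurable_EFinP; exact: measurableT_comp.
    - exact: exprn_ge0.
    by rewrite EFinM; apply: lee_wpmul2l => //; rewrite lee_fin exprn_ge0.
  rewrite sumEFin lee_fin -big_distrl/= mulrC ler_wpM2l//.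
  by apply: sum_geometric_le; rewrite r0.
have iS : P.-integrable setT S.
  apply/integrableP; split => //.
  under eq_integral do rewrite gee0_abs//.
  by rewrite (le_lt_trans intS)// ltry.
have := integrable_ae measurableT iS; apply: filterS => w /(_ I) Sfin.
apply: nondecreasing_is_cvgn.
  by apply: nondecreasing_series => n _ _; exact: a0.
exists (fine (S w)) => _ [n _ <-].
rewrite -lee_fin fineK// /series/= -sumEFin.
by apply: nneseries_lim_ge => k _ _; rewrite lee_fin; exact: a0.
Qed.

End laws.

Section generated_sigma_algebra.
Context d (T : measurableType d) (R : realType).
Implicit Types (F G : set (T -> R)) (f : T -> R).

(** Measurability with respect to the sigma-algebra generated by [F]. *)
Definition sigma_measurable F f :=
  forall B : set R, measurable B -> sigma_rv F (f @^-1` B).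

Let gen F := \bigcup_(f in F) preimage_set_system [set: T] f measurable.

Lemma sigma_measurableP F f : sigma_measurable F f <->
  measurable_fun [set: g_sigma_algebraType (gen F)] f.
Proof.
split=> [Ff _ B mB|Ff B mB]; first by rewrite setTI; exact: Ff.
by have := Ff measurableT B mB; rewrite setTI.
Qed.

Lemma sigma_measurable_mem F f : F f -> sigma_measurable F f.
Proof.
move=> Ff B mB; apply: sub_gen_smallest; exists f => //.
by exists B => //; rewrite setTI.
Qed.

Lemma sigma_measurableD F f g : sigma_measurable F f -> sigma_measurable F g ->
  sigma_measurable F (fun w => f w + g w).
Proof.
move=> /sigma_measurableP Ff /sigma_measurableP Fg; apply/sigma_measurableP.
exact: measurable_funD.
Qed.

Lemma sigma_measurableZ F f (c : R) : sigma_measurable F f ->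
  sigma_measurable F (fun w => c * f w).
Proof.
move=> /sigma_measurableP Ff; apply/sigma_measurableP.
by apply: measurable_funM => //; exact: measurable_cst.
Qed.

Lemma sigma_measurable_cst F (c : R) : sigma_measurable F (cst c).
Proof. by apply/sigma_measurableP; exact: measurable_cst. Qed.

Lemma sigma_measurable_sum F (I : eqType) (s : seq I) (h : I -> T -> R) :
  (forall i, i \in s -> sigma_measurable F (h i)) ->
  sigma_measurable F (fun w => \sum_(i <- s) h i w).
Proof.
elim: s => [|i s IH] Fh.
  by under eq_fun do rewrite big_nil; exact: sigma_measurable_cst.
under eq_fun do rewrite big_cons; apply: sigma_measurableD.
  by apply: Fh; rewrite mem_head.
by apply: IH => j js; apply: Fh; rewrite inE js orbT.
Qed.

Lemma sigma_measurable_comp F f (g : R -> R) : measurable_fun setT g ->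
  sigma_measurable F f -> sigma_measurable F (fun w => g (f w)).
Proof.
move=> mg Ff B mB; have := Ff (g @^-1` B); apply.
by rewrite -[X in measurable X]setTI; exact: mg.
Qed.

Lemma sub_sigma_rv F G : F `<=` G -> sigma_rv F `<=` sigma_rv G.
Proof.
move=> FG; apply: sub_smallest2r; first exact: smallest_sigma_algebra.
by move=> A [f Ff fA]; exists f => //; exact: FG.
Qed.

Lemma sigma_rv_measurable F : (forall f, F f -> measurable_fun setT f) ->
  sigma_rv F `<=` measurable.
Proof.
move=> mF; apply: smallest_sub; first exact: sigma_algebra_measurable.
by move=> _ [f Ff [B mB <-]]; exact: mF.
Qed.

End generated_sigma_algebra.

(** * Algebra of a periodic autoregression *)

(** Summation by the distance [j = n - m] to the end. *)
Lemma sum_rev (R : realType) (F : nat -> nat -> R) (n : nat) :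
  \sum_(0 <= m < n) F (n - m)%N m = \sum_(1 <= j < n.+1) F j (n - j)%N.
Proof.
rewrite big_nat_rev/= [RHS]big_add1/=; apply: eq_big_nat => i /andP[_ i_n].
by rewrite add0n; congr F; lia.
Qed.

Lemma sum_blocks (R : realType) (F : nat -> R) (p n : nat) :
  \sum_(p.+1 <= k < (n.+1 * p).+1) F k =
  \sum_(0 <= m < n) \sum_(1 <= r < p.+1) F (m * p + r + p)%N.
Proof.
elim: n => [|n IH]; first by rewrite mul1n !big_geq.
rewrite (@big_cat_nat _ _ _ (n.+1 * p).+1)/=; [|nia|nia].
rewrite IH [RHS]big_nat_recr//=; congr (_ + _).
rewrite -[(n.+1 * p).+1]add0n big_addn [RHS]big_add1/=.
rewrite (_ : (_ - _ = p)%N); last by nia.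
by apply: eq_bigr => i _; congr F; nia.
Qed.

Section periodic_coefficients.
Context (R : realType) (a : int -> R) (p : nat).
Hypothesis a_periodic : forall k : int, a (k + p%:Z) = a k.

Lemma AprodE (s r : int) (n : nat) : r + 1 = s + n%:Z ->
  Aprod a s r = \prod_(0 <= i < n) a (s + i%:Z).
Proof.
case: n => [|n] rs; rewrite /Aprod.
  by rewrite big_geq// ifF//; lia.
rewrite ifT; last by lia.
by rewrite big_mkord; have -> : `|r - s|%N = n by lia.
Qed.

Lemma Aprod_recr (s r : int) : s <= r + 1 ->
  Aprod a s (r + 1) = Aprod a s r * a (r + 1).
Proof.
move=> sr; have [n rn] : exists n : nat, r + 1 = s + n%:Z.
  by exists (absz (r + 1 - s)%R); lia.
rewrite (@AprodE s r n)// (@AprodE s (r + 1) n.+1); last by lia.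
by rewrite big_nat_recr//= -rn.
Qed.

Lemma Aprod_recl (s r : int) : s <= r ->
  Aprod a s r = a s * Aprod a (s + 1) r.
Proof.
move=> sr; have [n rn] : exists n : nat, r + 1 = s + 1 + n%:Z.
  by exists (absz (r - s)%R); lia.
rewrite (@AprodE (s + 1) r n)// (@AprodE s r n.+1); last by lia.
rewrite big_nat_recl//= addr0; congr (_ * _); apply: eq_bigr => i _.
by congr a; lia.
Qed.

Lemma Aprod_empty (s : int) : Aprod a (s + 1) s = 1.
Proof. by rewrite (@AprodE _ _ 0%N) ?big_geq//; lia. Qed.

Lemma periodic_mul (k : int) (m : nat) : a (k + (m * p)%N%:Z) = a k.
Proof.
elim: m => [|m IH]; first by rewrite mul0n addr0.
by rewrite -IH -[in RHS]a_periodic; congr a; lia.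
Qed.

Lemma Aprod_periodic (s r : int) (m : nat) :
  Aprod a (s + (m * p)%N%:Z) (r + (m * p)%N%:Z) = Aprod a s r.
Proof.
rewrite /Aprod lerD2r (_ : r + _ - (s + _) = r - s); last by lia.
case: ifP => // _; apply: eq_bigr => i _.
by rewrite -[RHS](periodic_mul _ m); congr a; rewrite addrAC.
Qed.

(** The product over any full period is [phi]. *)
Lemma Aprod_period (k : nat) : (0 < p)%N ->
  Aprod a (k%:Z + 1) (k + p)%N%:Z = phi a p.
Proof.
move=> p0; elim: k => [|k <-]; first by rewrite add0r add0n.
rewrite (@Aprod_recl (k%:Z + 1)); last by lia.
rewrite (_ : (k.+1 + p)%N%:Z = (k + p)%N%:Z + 1); last by lia.
rewrite Aprod_recr; last by lia.
rewrite mulrC (_ : (k + p)%N%:Z + 1 = k%:Z + 1 + p%:Z); last by lia.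
by rewrite a_periodic; congr (_ * Aprod a _ _); lia.
Qed.

(** The weights [1 / A_{r+1}^P]. *)
Definition weight (r : nat) : R := (Aprod a r.+1%:Z p%:Z)^-1.

Hypothesis phi_neq0 : phi a p != 0.

Lemma Aprod_neq0 (r : nat) : (r <= p)%N -> Aprod a r.+1%:Z p%:Z != 0.
Proof.
elim: r => [|r IH] rp; first exact: phi_neq0.
have := IH (ltnW rp); rewrite Aprod_recl; last by lia.
rewrite mulf_eq0 negb_or => /andP[_].
by rewrite (_ : r.+1%:Z + 1 = r.+2%:Z)//; lia.
Qed.

Lemma weight0 : weight 0 = (phi a p)^-1.
Proof. by []. Qed.

Lemma weightS (r : nat) : (r < p)%N -> weight r.+1 = a r.+1%:Z * weight r.
Proof.
move=> rp; have := Aprod_neq0 (ltnW rp).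
rewrite /weight (@Aprod_recl r.+1%:Z); last by lia.
rewrite (_ : r.+1%:Z + 1 = r.+2%:Z); last by lia.
rewrite mulf_eq0 negb_or => /andP[a0 A0].
by field; rewrite a0 A0.
Qed.

Lemma weight_neq0 (r : nat) : (r <= p)%N -> weight r != 0.
Proof. by move=> rp; rewrite invr_eq0 Aprod_neq0. Qed.

Lemma sum_weight_sqr_gt0 : (0 < p)%N ->
  0 < \sum_(1 <= r < p.+1) weight r ^+ 2.
Proof.
move=> p0; rewrite big_nat_recr//=; apply: ltr_wpDl.
  by apply: sumr_ge0 => r _; exact: sqr_ge0.
by rewrite exprn_even_gt0//= weight_neq0.
Qed.

End periodic_coefficients.

Section trajectory.
Context (R : realType) (a : int -> R) (p : nat).
Hypothesis p_gt0 : (0 < p)%N.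
Hypothesis a_periodic : forall k : int, a (k + p%:Z) = a k.
Variables (X : nat -> R) (u : int -> R).
Hypothesis X_rec : forall k : nat, X k.+1 = a k.+1%:Z * X k + u k.+1%:Z.

Local Notation phi := (phi a p).
Local Notation b := (weight a p).

(** The innovation of the process over one period. *)
Definition innovation (k : nat) : R := X (k + p)%N - phi * X k.

Local Notation V := innovation.

(** The recursion unrolled over [i] steps. *)
Lemma trajectoryE (k i : nat) : X (k + i)%N =
  Aprod a (k%:Z + 1) (k + i)%N%:Z * X k +
  \sum_(0 <= l < i) Aprod a ((k + i)%N%:Z - l%:Z + 1) (k + i)%N%:Z *
    u ((k + i)%N%:Z - l%:Z).
Proof.
elim: i => [|i IH].
  by rewrite big_geq// addn0 Aprod_empty mul1r addr0.
rewrite addnS X_rec IH big_nat_recl//= subr0 Aprod_empty mul1r.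
rewrite (_ : (k + i).+1%:Z = (k + i)%N%:Z + 1); last by lia.
rewrite Aprod_recr; last by lia.
rewrite mulrDr mulrA [a _ * _]mulrC -addrA; congr (_ + _).
rewrite addrC; congr (_ + _); rewrite big_distrr/=.
apply: eq_big_nat => l /andP[_ li].
rewrite (_ : (k + i)%N%:Z + 1 - l.+1%:Z = (k + i)%N%:Z - l%:Z); last by lia.
by rewrite Aprod_recr ?mulrA 1?[a _ * _]mulrC//; lia.
Qed.

Lemma innovationE (m r : nat) : V (m * p + r)%N =
  \sum_(0 <= k < p) Aprod a (r%:Z - k%:Z + 1) r%:Z *
    u ((m.+1 * p + r)%N%:Z - k%:Z).
Proof.
rewrite /V trajectoryE Aprod_period//.
rewrite addrAC subrr add0r; apply: eq_big_nat => k _.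
congr (_ * u _); last by lia.
by rewrite -[RHS](@Aprod_periodic _ a p a_periodic _ _ m.+1); congr (Aprod a _ _); lia.
Qed.

Lemma period_step (n : nat) : X (n.+1 * p)%N = phi * X (n * p)%N +
  \sum_(1 <= s < p.+1) Aprod a s.+1%:Z p%:Z * u (n * p + s)%N%:Z.
Proof.
have := trajectoryE (n * p) p; rewrite Aprod_period//.
rewrite (_ : (n * p + p = n.+1 * p)%N); last by lia.
move=> ->; congr (_ + _); rewrite big_nat_rev/= [RHS]big_add1/=.
apply: eq_big_nat => k /andP[_ kp].
congr (_ * u _); last by lia.
by rewrite -[RHS](@Aprod_periodic _ a p a_periodic _ _ n); congr (Aprod a _ _); lia.
Qed.

Hypothesis phi_gt1 : 1 < `|phi|.

Lemma phi_neq0 : phi != 0.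
Proof. by rewrite -normr_gt0 (lt_trans _ phi_gt1). Qed.

Lemma trajectory_at_periods (n : nat) : X (n.+1 * p)%N = phi ^+ n.+1 *
  (X 0%N + \sum_(0 <= l < n.+1) phi ^- l.+1 *
    \sum_(1 <= s < p.+1) Aprod a s.+1%:Z p%:Z * u (l * p + s)%N%:Z).
Proof.
have phi0 := phi_neq0.
elim: n => [|n IH].
  rewrite period_step big_nat1 expr1 mulrDr mulVKf// mul0n.
rewrite period_step IH [in RHS]big_nat_recr//= addrA [RHS]mulrDr.
by rewrite mulVKf ?expf_neq0// [phi ^+ n.+2]exprS mulrA.
Qed.

(** The trajectory normalised by its growth. *)
Definition normalised (r m : nat) : R := phi ^- m.+1 * X (m * p + r)%N.

Local Notation x := normalised.

Lemma normalisedK (r m : nat) : X (m * p + r)%N = phi ^+ m.+1 * x r m.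
Proof. by rewrite /x mulVKf// expf_neq0// phi_neq0. Qed.

Lemma cvg_normalised (W : R) (r : nat) : (r <= p)%N ->
  (X 0%N + \sum_(0 <= l < n.+1) phi ^- l.+1 *
    \sum_(1 <= s < p.+1) Aprod a s.+1%:Z p%:Z * u (l * p + s)%N%:Z)
    @[n --> \oo] --> W ->
  (forall s, (s <= p)%N -> (phi ^- m * u (m * p + s)%N%:Z) @[m --> \oo] --> 0) ->
  x r m @[m --> \oo] --> W * b r.
Proof.
move=> rp ZW u0; have phi0 := phi_neq0.
elim: r rp => [|r IH] rp.
  rewrite -cvg_shiftS /=.
  have -> : (fun n => x 0 n.+1) = (fun n => (X 0%N + \sum_(0 <= l < n.+1) phi ^- l.+1 *
    \sum_(1 <= s < p.+1) Aprod a s.+1%:Z p%:Z * u (l * p + s)%N%:Z) * b 0).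
    apply/funext => n; rewrite /x addn0 trajectory_at_periods weight0.
    by rewrite mulrA exprS invfM divfK ?expf_neq0// mulrC.
  by apply: cvgMr_tmp.
have {}IH := IH (ltnW rp).
have -> : x r.+1 = (fun m => a r.+1%:Z * x r m +
    phi^-1 * (phi ^- m * u (m * p + r.+1)%N%:Z)).
  apply/funext => m; rewrite /x addnS X_rec.
  rewrite (_ : a (m * p + r).+1%:Z = a r.+1%:Z); last first.
    by rewrite -(@periodic_mul _ a p a_periodic r.+1%:Z m); congr a; lia.
  by rewrite mulrDr mulrCA [in RHS]mulrA -invfM -exprS.
rewrite weightS// ?phi_neq0// mulrCA -[X in _ --> X]addr0; apply: cvgD.
  exact: cvgMl_tmp.
by rewrite -[X in _ --> X](mulr0 phi^-1); apply: cvgMl_tmp; exact: u0.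
Qed.

End trajectory.

(** * The least squares error along a trajectory *)

Lemma ler_sum_prod (R : realType) I (s : seq I) (f g : I -> R) :
  (forall i, 0 <= f i) -> (forall i, 0 <= g i) ->
  \sum_(i <- s) f i * g i <= (\sum_(i <- s) f i) * (\sum_(i <- s) g i).
Proof.
move=> f0 g0; elim: s => [|i s IH]; first by rewrite !big_nil mul0r.
rewrite !big_cons mulrDl !mulrDr -addrA lerD2l.
have fs : 0 <= \sum_(j <- s) f j by exact: sumr_ge0.
have gs : 0 <= \sum_(j <- s) g j by exact: sumr_ge0.
by rewrite (le_trans IH)// addrA lerDr addr_ge0// mulr_ge0.
Qed.

(** The least squares estimator along a single trajectory [X]; it is 0 where the
    denominator vanishes. *)
Definition least_squares (R : realType) (p : nat) (X : nat -> R) (n : nat) : R :=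
  (\sum_(p.+1 <= k < (n * p).+1) X k * X (k - p)%N) /
  (\sum_(p.+1 <= k < (n * p).+1) (X (k - p)%N) ^+ 2).

Section least_squares_error.
Context (R : realType) (a : int -> R) (p : nat).
Hypothesis p_gt0 : (0 < p)%N.
Hypothesis phi_gt1 : 1 < `|phi a p|.
Variable X : nat -> R.

Local Notation phi := (phi a p).
Local Notation rho := phi^-1.
Local Notation b := (weight a p).
Local Notation V := (innovation a p X).
Local Notation x := (normalised a p X).

Let phi0 : phi != 0. Proof. exact: phi_neq0 phi_gt1. Qed.

(** The total size of the innovations of one period. *)
Definition block_size (m : nat) : R := \sum_(1 <= r < p.+1) `|V (m * p + r)%N|.

(** The square root of the contraction rate: [|rho| ^ j = rate ^ j * rate ^ j], so
    that one factor is spent on convergence and the other one on integrability. *)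
Definition rate : R := Num.sqrt `|rho|.

(** The factor [B_n], bounded in mean, of the domination of the remainders. *)
Definition dominating (n : nat) : R :=
  \sum_(1 <= j < n.+1) rate ^+ j * block_size (n - j).

(** The numerator of the error of [least_squares p X n.+1], divided by [phi ^ n.+1]. *)
Definition error_sum (n : nat) : R := \sum_(0 <= m < n)
  rho ^+ (n - m) * \sum_(1 <= r < p.+1) V (m * p + r)%N * x r m.

(** Its denominator, divided by [phi ^ (2 * n.+1)]. *)
Definition square_sum (n : nat) : R := \sum_(0 <= m < n)
  (rho ^+ 2) ^+ (n - m) * \sum_(1 <= r < p.+1) x r m ^+ 2.

(** The contribution of the last [J] periods to the linearised error [T_n], which is
    [linear_error n n]. *)
Definition linear_error (n J : nat) : R := \sum_(1 <= j < J.+1)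
  rho ^+ j * \sum_(1 <= r < p.+1) b r * V ((n - j) * p + r)%N.

Lemma rho_lt1 : `|rho| < 1.
Proof. by rewrite normfV invf_lt1// (lt_trans _ phi_gt1). Qed.

Lemma rate_ge0 : 0 <= rate. Proof. exact: sqrtr_ge0. Qed.

Lemma rate_sqr (j : nat) : `|rho| ^+ j = rate ^+ j * rate ^+ j.
Proof. by rewrite -exprMn -expr2 sqr_sqrtr. Qed.

Lemma rate_lt1 : rate < 1.
Proof. by rewrite -sqrtr1 ltr_sqrt// rho_lt1. Qed.

Lemma block_size_ge0 m : 0 <= block_size m.
Proof. by apply: sumr_ge0. Qed.

Lemma dominating_ge0 n : 0 <= dominating n.
Proof.
by apply: sumr_ge0 => j _; rewrite mulr_ge0 ?exprn_ge0 ?rate_ge0 ?block_size_ge0.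
Qed.

Lemma least_squares_error (n : nat) : square_sum n != 0 ->
  phi ^+ n.+1 * (least_squares p X n.+1 - phi) = error_sum n / square_sum n.
Proof.
move=> D0; have pn0 : phi ^+ n.+1 != 0 by rewrite expf_neq0.
have XE (r m : nat) : X (m * p + r)%N = phi ^+ m.+1 * x r m by exact: normalisedK.
have phiE (m : nat) : (m < n)%N -> phi ^+ m.+1 = phi ^+ n.+1 * rho ^+ (n - m).
  move=> mn; rewrite exprVn (_ : n.+1 = (m.+1 + (n - m))%N); last by lia.
  by rewrite exprD mulfK// expf_neq0.
have denE : \sum_(p.+1 <= k < (n.+1 * p).+1) (X (k - p)%N) ^+ 2 =
    (phi ^+ n.+1) ^+ 2 * square_sum n.
  rewrite (sum_blocks (fun k => (X (k - p)%N) ^+ 2)) big_distrr/=.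
  apply: eq_big_nat => m /andP[_ mn].
  rewrite mulrA [(rho ^+ 2) ^+ _]exprAC -exprMn -phiE//.
  rewrite big_distrr/=; apply: eq_bigr => r _.
  by rewrite addnK XE exprMn.
have numE : \sum_(p.+1 <= k < (n.+1 * p).+1) X k * X (k - p)%N =
    phi * ((phi ^+ n.+1) ^+ 2 * square_sum n) + phi ^+ n.+1 * error_sum n.
  rewrite -denE (sum_blocks (fun k => (X (k - p)%N) ^+ 2)).
  rewrite (sum_blocks (fun k => X k * X (k - p)%N)) !big_distrr/= -big_split/=.
  apply: eq_big_nat => m /andP[_ mn]; rewrite mulrA -phiE// !big_distrr/= -big_split/=.
  apply: eq_bigr => r _; rewrite addnK [phi ^+ m.+1 * _]mulrCA -XE /innovation.
  by ring.
rewrite /least_squares numE denE.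
by field; rewrite D0 pn0.
Qed.

(** One of the two factors [rate ^ j] is replaced by [rate ^ k], the other one is kept
    for summation. *)
Lemma linear_term_le (j k m : nat) : (k <= j)%N ->
  `|rho ^+ j * \sum_(1 <= r < p.+1) b r * V (m * p + r)%N| <=
    (\sum_(1 <= r < p.+1) `|b r|) * rate ^+ k * (rate ^+ j * block_size m).
Proof.
move=> kj; have rj := exprn_ge0 j rate_ge0.
rewrite normrM normrX rate_sqr.
have h : `|\sum_(1 <= r < p.+1) b r * V (m * p + r)%N| <=
    (\sum_(1 <= r < p.+1) `|b r|) * block_size m.
  rewrite (le_trans (ler_norm_sum _ _ _))//.
  rewrite (eq_bigr (fun r => `|b r| * `|V (m * p + r)%N|)); last first.
    by move=> r _; rewrite normrM.
  exact: ler_sum_prod.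
have jk : rate ^+ j <= rate ^+ k.
  by rewrite ler_wiXn2l// ?rate_ge0// ltW// rate_lt1.
rewrite [leRHS](_ : _ = rate ^+ k * rate ^+ j *
  ((\sum_(1 <= r < p.+1) `|b r|) * block_size m)); last by ring.
by apply: ler_pM => //; [rewrite mulr_ge0|rewrite ler_wpM2r].
Qed.

Let tail_ge0 (n : nat) (s : seq nat) :
  0 <= \sum_(j <- s) rate ^+ j * block_size (n - j).
Proof.
by rewrite sumr_ge0// => j _; rewrite mulr_ge0 ?exprn_ge0 ?rate_ge0 ?block_size_ge0.
Qed.

Lemma linear_error_le (n J : nat) : (J <= n)%N ->
  `|linear_error n J| <= (\sum_(1 <= r < p.+1) `|b r|) * dominating n.
Proof.
move=> Jn; rewrite (@le_trans _ _ ((\sum_(1 <= r < p.+1) `|b r|) *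
  \sum_(1 <= j < J.+1) rate ^+ j * block_size (n - j)))//; last first.
  rewrite ler_wpM2l ?sumr_ge0// /dominating (@big_cat_nat _ _ _ J.+1 1 n.+1)//=.
  by rewrite lerDl; exact: tail_ge0.
rewrite big_distrr/= (le_trans (ler_norm_sum _ _ _))//; apply: ler_sum => j _.
by have := @linear_term_le j 0 (n - j) isT; rewrite expr0 mulr1.
Qed.

Lemma linear_error_tail_le (n J : nat) : (J <= n)%N ->
  `|linear_error n n - linear_error n J| <=
    (\sum_(1 <= r < p.+1) `|b r|) * rate ^+ J * dominating n.
Proof.
move=> Jn; rewrite /linear_error (@big_cat_nat _ _ _ J.+1 1 n.+1)//=.
rewrite addrAC subrr add0r /dominating (@big_cat_nat _ _ _ J.+1 1 n.+1)//=.
rewrite mulrDr ler_wpDl//.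
  apply: mulr_ge0; last exact: tail_ge0.
  by rewrite mulr_ge0 ?sumr_ge0 ?exprn_ge0 ?rate_ge0.
rewrite big_distrr/= (le_trans (ler_norm_sum _ _ _))//.
by apply: ler_sum_nat => j /andP[Jj _]; apply: linear_term_le; exact: ltnW.
Qed.

Variable W : R.
Hypothesis W_neq0 : W != 0.
Hypothesis cvg_x : forall r, (r <= p)%N -> x r m @[m --> \oo] --> W * b r.

(** The constant of the limit law: the normalised denominator tends to
    [W ^ 2 / limit_constant]. *)
Definition limit_constant : R := (phi ^+ 2 - 1) / \sum_(1 <= r < p.+1) b r ^+ 2.

Local Notation c := limit_constant.

Let sumr_in (F G : nat -> R) : (forall r, (r <= p)%N -> F r = G r) ->
  \sum_(1 <= r < p.+1) F r = \sum_(1 <= r < p.+1) G r.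
Proof. by move=> FG; apply: eq_big_nat => r /andP[_ rp]; exact: FG. Qed.

Lemma cvg_sum_in (F : nat -> nat -> R) (l : nat -> R) :
  (forall r, (r <= p)%N -> F r m @[m --> \oo] --> l r) ->
  \sum_(1 <= r < p.+1) F r m @[m --> \oo] --> \sum_(1 <= r < p.+1) l r.
Proof.
move=> Fl; pose F' r m := if (r <= p)%N then F r m else 0.
pose l' r := if (r <= p)%N then l r else 0.
have -> : (fun m => \sum_(1 <= r < p.+1) F r m) = fun m => \sum_(1 <= r < p.+1) F' r m.
  by apply/funext => m; apply: sumr_in => r rp; rewrite /F' rp.
rewrite (@sumr_in l l'); last by move=> r rp; rewrite /l' rp.
apply: cvg_sumr => r; rewrite /F' /l'; case: leqP => rp; last exact: cvg_cst.
exact: Fl.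
Qed.

Lemma cvg_square_sum : square_sum n @[n --> \oo] --> W ^+ 2 / c.
Proof.
have S0 := sum_weight_sqr_gt0 phi0 p_gt0.
have phi2 : 0 < phi ^+ 2 - 1.
  rewrite subr_gt0 -real_normK ?num_real//.
  by rewrite exprn_egt1.
have -> : W ^+ 2 / c = rho ^+ 2 / (1 - rho ^+ 2) * \sum_(1 <= r < p.+1) (W * b r) ^+ 2.
  under eq_bigr do rewrite exprMn.
  rewrite -big_distrr/= /c invf_div exprVn.
  set S := \sum_(1 <= r < p.+1) _ in S0 *.
  by field; rewrite phi0 !gt_eqF//.
apply: cvg_geometric_convolution.
  by rewrite normrX exprn_ilt1// rho_lt1.
apply: cvg_sum_in => r rp.
by rewrite expr2; under eq_cvg do rewrite expr2; apply: cvgM; exact: cvg_x.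
Qed.

Lemma limit_constant_neq0 : c != 0.
Proof.
have S0 := sum_weight_sqr_gt0 phi0 p_gt0.
have phi2 : 0 < phi ^+ 2 - 1.
  by rewrite subr_gt0 -real_normK ?num_real// exprn_egt1.
by rewrite mulf_neq0// ?invr_eq0 gt_eqF.
Qed.

Lemma near_square_sum_neq0 : \forall n \near \oo, square_sum n != 0.
Proof.
apply: (cvgr_neq0 _ cvg_square_sum).
by rewrite mulf_neq0 ?expf_neq0 ?invr_eq0 ?limit_constant_neq0.
Qed.

(** Strong consistency along a trajectory. *)
Lemma cvg_least_squares : least_squares p X n @[n --> \oo] --> phi.
Proof.
rewrite -cvg_shiftS /=.
(* [rho ^ m.+1 * V] is [phi] times a difference of consecutive terms of a convergent
   sequence. *)
have Vx (r : nat) : (r <= p)%N -> (rho ^+ m.+1 * V (m * p + r)%N) @[m --> \oo] --> 0.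
  move=> rp; have -> : (fun m => rho ^+ m.+1 * V (m * p + r)%N) =
      (fun m => phi * (x r m.+1 - x r m)).
    apply/funext => m; rewrite /normalised /innovation exprVn.
    rewrite (_ : (m * p + r + p)%N = (m.+1 * p + r)%N); last by lia.
    rewrite !mulrBr [in RHS]exprS invfM [in RHS]mulrA mulVKf//.
    by rewrite mulrCA.
  rewrite -[X in _ --> X](mulr0 phi) -(subrr (W * b r)); apply: cvgMl_tmp.
  by apply: cvgB; [rewrite cvg_shiftS; exact: cvg_x|exact: cvg_x].
have num0 : rho ^+ n.+1 * error_sum n @[n --> \oo] --> 0.
  have -> : (fun n => rho ^+ n.+1 * error_sum n) = (fun n => \sum_(0 <= m < n)
      (rho ^+ 2) ^+ (n - m) *
        \sum_(1 <= r < p.+1) (rho ^+ m.+1 * V (m * p + r)%N) * x r m).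
    apply/funext => n; rewrite big_distrr/=; apply: eq_big_nat => m /andP[_ mn].
    rewrite !big_distrr/=; apply: eq_bigr => r _.
    rewrite (_ : n.+1 = (m.+1 + (n - m))%N); last by lia.
    by rewrite exprD exprAC expr2; ring.
  rewrite -[X in _ --> X](mulr0 (rho ^+ 2 / (1 - rho ^+ 2))).
  apply: cvg_geometric_convolution; first by rewrite normrX exprn_ilt1// rho_lt1.
  rewrite [X in _ --> X](_ : 0 = \sum_(1 <= r < p.+1) 0 * (W * b r)); last first.
    by rewrite big1// => r _; rewrite mul0r.
  by apply: cvg_sum_in => r rp; apply: cvgM; [exact: Vx|exact: cvg_x].
have lim : (rho ^+ n.+1 * error_sum n / square_sum n + phi) @[n --> \oo] --> phi.
  rewrite -[X in _ --> X]add0r; apply: cvgD; last exact: cvg_cst.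
  rewrite -[X in _ --> X](mul0r (W ^+ 2 / c)^-1); apply: cvgM => //.
  apply: cvgV; last exact: cvg_square_sum.
  by rewrite mulf_neq0 ?expf_neq0 ?invr_eq0 ?limit_constant_neq0.
apply: cvg_trans lim; apply: near_eq_cvg.
near=> n; have D0 : square_sum n != 0 by near: n; exact: near_square_sum_neq0.
rewrite -mulrA -least_squares_error// exprVn mulKf ?expf_neq0//.
by rewrite subrK.
Unshelve. all: by end_near. Qed.

(** The distance, over one period, of the normalised trajectory to its limit. *)
Definition discrepancy (m : nat) : R := \sum_(1 <= r < p.+1) `|x r m - W * b r|.

(** The convolution of [discrepancy] with the geometric weights [rate ^ j]. *)
Definition weighted_discrepancy (n : nat) : R :=
  \sum_(0 <= m < n) rate ^+ (n - m) * discrepancy m.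

Lemma discrepancy_ge0 m : 0 <= discrepancy m.
Proof. by apply: sumr_ge0. Qed.

Lemma cvg_weighted_discrepancy : weighted_discrepancy n @[n --> \oo] --> 0.
Proof.
rewrite -[X in _ --> X](mulr0 (rate / (1 - rate))).
apply: cvg_geometric_convolution.
  by rewrite ger0_norm ?rate_ge0 ?rate_lt1.
rewrite [X in _ --> X](_ : 0 = \sum_(1 <= r < p.+1) 0); last by rewrite big1.
apply: cvg_sum_in => r rp; rewrite -(normr0 R); apply: cvg_norm.
by rewrite -(subrr (W * b r)); apply: cvgB; [exact: cvg_x|exact: cvg_cst].
Qed.

Lemma error_sum_linear_le (n : nat) :
  `|error_sum n - W * linear_error n n| <= weighted_discrepancy n * dominating n.
Proof.
have -> : linear_error n n = \sum_(0 <= m < n)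
    rho ^+ (n - m) * \sum_(1 <= r < p.+1) b r * V (m * p + r)%N.
  rewrite (sum_rev (fun j m => rho ^+ j * \sum_(1 <= r < p.+1) b r * V (m * p + r)%N)).
  by [].
have -> : dominating n = \sum_(0 <= m < n) rate ^+ (n - m) * block_size m.
  by rewrite (sum_rev (fun j m => rate ^+ j * block_size m)).
rewrite big_distrr/= -sumrB (le_trans (ler_norm_sum _ _ _))//.
rewrite (@le_trans _ _ (\sum_(0 <= m < n) (rate ^+ (n - m) * discrepancy m) *
    (rate ^+ (n - m) * block_size m)))//; last first.
  by apply: ler_sum_prod => m; rewrite mulr_ge0 ?exprn_ge0 ?rate_ge0
    ?discrepancy_ge0 ?block_size_ge0.
apply: ler_sum => m _; rewrite mulrCA -mulrBr normrM normrX rate_sqr mulrACA.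
rewrite ler_wpM2l ?mulr_ge0 ?exprn_ge0 ?rate_ge0// big_distrr/= -sumrB.
rewrite (le_trans (ler_norm_sum _ _ _))//.
rewrite (@le_trans _ _ (\sum_(1 <= r < p.+1) `|x r m - W * b r| * `|V (m * p + r)%N|))//.
  by apply: ler_sum => r _; rewrite -normrM le_eqVlt; apply/orP; left;
    apply/eqP; congr (`|_|); ring.
exact: ler_sum_prod.
Qed.

(** The vanishing factor in the linearisation of the least squares error. *)
Definition vanishing (n : nat) : R :=
  weighted_discrepancy n / `|square_sum n| +
  (\sum_(1 <= r < p.+1) `|b r|) * `|W / square_sum n - c / W| +
  `|c / W| * ((\sum_(1 <= r < p.+1) `|b r|) * rate ^+ n./2).

Lemma cvg_vanishing : vanishing n @[n --> \oo] --> 0.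
Proof.
have l0 : W ^+ 2 / c != 0.
  by rewrite mulf_neq0 ?expf_neq0 ?invr_eq0 ?limit_constant_neq0.
rewrite [X in _ --> X](_ : 0 = 0 / `|W ^+ 2 / c| +
  (\sum_(1 <= r < p.+1) `|b r|) * `|W / (W ^+ 2 / c) - c / W| +
  `|c / W| * ((\sum_(1 <= r < p.+1) `|b r|) * 0)); last first.
  rewrite mul0r !mulr0 addr0 add0r (_ : W / (W ^+ 2 / c) = c / W) ?subrr ?normr0 ?mulr0//.
  by field; rewrite W_neq0 limit_constant_neq0.
have cS := cvg_square_sum.
apply: cvgD; [apply: cvgD|].
- apply: cvgM; first exact: cvg_weighted_discrepancy.
  by apply: cvgV; [rewrite normr_eq0|exact: cvg_norm].
- apply: cvgMl_tmp; apply: cvg_norm; apply: cvgB; last exact: cvg_cst.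
  by apply: cvgMl_tmp; exact: cvgV.
do 2 apply: cvgMl_tmp.
have : rate ^+ n @[n --> \oo] --> 0.
  by apply: cvg_expr; rewrite ger0_norm ?rate_ge0 ?rate_lt1.
move/cvgr0Pnorm_le => h; apply/cvgr0Pnorm_le => e e0.
have [N _ HN] := h e e0; exists N.*2 => //= n /= Nn; apply: HN => /=.
by lia.
Qed.

Lemma least_squares_linearisation : \forall n \near \oo,
  `|phi ^+ n.+1 * (least_squares p X n.+1 - phi) -
    c * (linear_error n n./2 * W^-1)| <= vanishing n * dominating n.
Proof.
near=> n; have D0 : square_sum n != 0 by near: n; exact: near_square_sum_neq0.
have n2 : (n./2 <= n)%N by lia.
rewrite least_squares_error//.
set E := error_sum n; set D := square_sum n in D0 *; set L := linear_error n n.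
set L2 := linear_error n n./2; set B := dominating n.
have -> : E / D - c * (L2 * W^-1) =
  (E - W * L) / D + L * (W / D - c / W) + c / W * (L - L2).
  by field; rewrite D0 W_neq0.
rewrite /vanishing [leRHS]mulrDl (le_trans (ler_normD _ _))// lerD//; last first.
  by rewrite normrM -[leRHS]mulrA ler_wpM2l//; exact: linear_error_tail_le.
rewrite [leRHS]mulrDl (le_trans (ler_normD _ _))// lerD//.
  rewrite normrM normfV [leRHS]mulrAC ler_wpM2r ?invr_ge0//.
  exact: error_sum_linear_le.
rewrite normrM [leRHS]mulrAC ler_wpM2r//.
exact: linear_error_le.
Unshelve. all: by end_near. Qed.

End least_squares_error.

(** * Moments and almost sure behaviour *)

Section mean_bounds.
Context d (T : measurableType d) (R : realType) (P : probability T R).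

(** [f] is a nonnegative random variable with mean at most [C]. *)
Definition mean_le (f : T -> R) (C : R) :=
  [/\ measurable_fun setT f, forall w, 0 <= f w &
      (\int[P]_w (f w)%:E <= C%:E)%E].

Lemma mean_leZ (f : T -> R) (C k : R) : 0 <= k -> mean_le f C ->
  mean_le (fun w => k * f w) (k * C).
Proof.
move=> k0 [mf f0 fC]; split.
- exact: measurable_funM.
- by move=> w; rewrite mulr_ge0.
under eq_integral do rewrite EFinM.
rewrite ge0_integralZl_EFin//; last 2 first.
- by move=> w _; rewrite lee_fin.
- exact/measurable_EFinP.
by rewrite EFinM; apply: lee_wpmul2l => //; rewrite lee_fin.
Qed.

Lemma mean_le_sum I (s : seq I) (f : I -> T -> R) (C : I -> R) :
  (forall i, mean_le (f i) (C i)) ->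
  mean_le (fun w => \sum_(i <- s) f i w) (\sum_(i <- s) C i).
Proof.
move=> fC; split.
- by apply: measurable_sumr => i; case: (fC i).
- by move=> w; apply: sumr_ge0 => i _; case: (fC i).
under eq_integral do rewrite -sumEFin.
rewrite ge0_integral_sum//; first last.
- by move=> i w _; rewrite lee_fin; case: (fC i).
- by move=> i; apply/measurable_EFinP; case: (fC i).
by rewrite -sumEFin; apply: lee_sum => i _; case: (fC i).
Qed.

Lemma mean_le_trans (f g : T -> R) (C : R) : measurable_fun setT f ->
  (forall w, 0 <= f w <= g w) -> mean_le g C -> mean_le f C.
Proof.
move=> mf fg [mg g0 gC]; split => //; first by move=> w; case/andP: (fg w).
apply: le_trans gC; apply: ge0_le_integral => //.
- by move=> w _; rewrite lee_fin; case/andP: (fg w).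
- exact/measurable_EFinP.
- exact/measurable_EFinP.
by move=> w _; rewrite lee_fin; case/andP: (fg w).
Qed.

Lemma mean_le_norm_sum I (s : seq I) (k : I -> R) (f : I -> T -> R) (C : R) :
  (forall i, measurable_fun setT (f i)) ->
  (forall i, mean_le (fun w => `|f i w|) C) ->
  mean_le (fun w => `|\sum_(i <- s) k i * f i w|) (\sum_(i <- s) `|k i| * C).
Proof.
move=> mf fC.
have := mean_le_sum s (fun i => mean_leZ (normr_ge0 (k i)) (fC i)).
apply: mean_le_trans.
  apply: measurableT_comp => //; apply: measurable_sumr => i.
  exact: measurable_funM.
move=> w; rewrite normr_ge0 (le_trans (ler_norm_sum _ _ _))//.
by apply: ler_sum => i _; rewrite normrM.
Qed.

End mean_bounds.

Lemma measurable_nth_tuple (R : realType) (N i : nat) :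
  measurable_fun [set: N.-tuple R] (fun t => nth 0 t i).
Proof.
have [iN|Ni] := ltnP i N.
  rewrite (_ : (fun t => _) = (fun t : N.-tuple R => tnth t (Ordinal iN))).
    exact: measurable_tnth.
  by apply/funext => t; rewrite (tnth_nth 0).
rewrite (_ : (fun t => _) = cst 0); first exact: measurable_cst.
by apply/funext => t; rewrite nth_default// size_tuple.
Qed.

Lemma measurable_mktuple d (T : measurableType d) (R : realType) (N : nat)
    (f : nat -> T -> R) : (forall i, measurable_fun setT (f i)) ->
  measurable_fun setT (fun w => [tuple f i w | i < N]).
Proof.
move=> mf; apply/measurable_fun_tnthP => i /=.
rewrite (_ : _ \o _ = f i); first exact: mf.
by apply/funext => w /=; rewrite tnth_mktuple.
Qed.

Lemma nth_mktuple_ord (R : realType) (N i : nat) (f : nat -> R) : (i < N)%N ->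
  nth 0 [tuple f j | j < N] i = f i.
Proof. by move=> iN; rewrite -(tnth_nth 0 _ (Ordinal iN)) tnth_mktuple. Qed.

(** Equality of the laws of two vectors gives equality of the absolute moments of
    their entries. *)
Lemma same_law_entry d (T : measurableType d) (R : realType) (P : probability T R)
    (N i : nat) (f g : nat -> T -> R) : (i < N)%N ->
  (forall j, measurable_fun setT (f j)) -> (forall j, measurable_fun setT (g j)) ->
  same_law P (fun w => [tuple f j w | j < N]) (fun w => [tuple g j w | j < N]) ->
  (\int[P]_w `|f i w|%:E = \int[P]_w `|g i w|%:E)%E.
Proof.
move=> iN mf mg fg.
have := @same_law_integral _ T R P _ _ _ _ (fun t : N.-tuple R => `|nth 0 t i|)
  (measurable_mktuple mf) (measurable_mktuple mg) fg.
move=> /(_ _ (fun t => normr_ge0 _)).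
have mn : measurable_fun [set: N.-tuple R] (fun t : N.-tuple R => `|nth 0 t i|).
  by apply: measurableT_comp => //; exact: measurable_nth_tuple.
move=> /(_ mn); congr (_ = _); apply: eq_integral => w _.
  by rewrite (nth_mktuple_ord (fun j => f j w)).
by rewrite (nth_mktuple_ord (fun j => g j w)).
Qed.

Section par_moments.
Context d (T : measurableType d) (R : realType) (P : probability T R).
Context (a : int -> R) (p : nat).
Hypothesis p_gt0 : (0 < p)%N.
Variable u : int -> {RV P >-> R}.
Hypothesis u_square : forall k : int, (u k : T -> R) \in Lfun P 2%:E.
Hypothesis u_periodic : periodically_distributed p u.

Let mu (k : int) : measurable_fun setT (u k).
Proof. exact: measurable_funPT. Qed.

Let absolute_moment (k : int) := (\int[P]_w `|u k w|%:E)%E.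

Lemma absolute_moment_periodic (k : int) (m : nat) :
  absolute_moment (k + (m * p)%N%:Z) = absolute_moment k.
Proof.
elim: m => [|m IH]; first by rewrite mul0n addr0.
rewrite -IH /absolute_moment.
have := @same_law_entry _ T R P 1 0 (fun i => u (p%:Z + (k + (m * p)%N%:Z) + i%:Z))
  (fun i => u (k + (m * p)%N%:Z + i%:Z)) isT (fun i => mu _) (fun i => mu _)
  (@u_periodic _ 0%N).
rewrite !addr0 => <-.
by rewrite (_ : k + (m.+1 * p)%N%:Z = p%:Z + (k + (m * p)%N%:Z))//; lia.
Qed.

(** By periodicity, the moments over one period bound all of them. *)
Lemma bounded_absolute_moments : exists C : R,
  forall k : int, mean_le P (fun w => `|u k w|) C.
Proof.
have fin (k : int) : (\int[P]_w `|u k w|%:E < +oo)%E.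
  have : (u k : T -> R) \in Lfun P 1.
    by apply: Lfun_subset12 => //; exact: fin_num_measure.
  by move=> /Lfun1_integrable/integrableP[_].
have ge0 (k : int) : (0 <= absolute_moment k)%E.
  by apply: integral_ge0 => w _; rewrite lee_fin.
exists (\sum_(s < p) fine (absolute_moment s%:Z)) => k; split.
- by apply: measurableT_comp => //; exact: mu.
- by [].
(* Adding [|k|] periods makes the index nonnegative; it is then reduced modulo [p]. *)
rewrite -/(absolute_moment k) -(absolute_moment_periodic k `|k|%N).
have [n ->] : exists n : nat, k + (`|k| * p)%N%:Z = n%:Z.
  exists (absz (k + (`|k| * p)%N%:Z)%R); nia.
have [s [m ->]] : exists (s : 'I_p) (m : nat), n%:Z = s%:Z + (m * p)%N%:Z.
  exists (Ordinal (ltn_pmod n p_gt0)), (n %/ p)%N.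
  by rewrite /= -PoszD {1}(divn_eq n p) addnC.
rewrite absolute_moment_periodic -[leLHS]fineK; last first.
  by rewrite ge0_fin_numE//; exact: fin.
by rewrite lee_fin (bigD1 s)//= lerDl sumr_ge0// => i _; rewrite fine_ge0.
Qed.

End par_moments.

(** The limit of measurable functions is measurable, including the default value
    taken where the sequence diverges. *)
Lemma measurable_limn d (T : measurableType d) (R : realType) (f : nat -> T -> R) :
  (forall n, measurable_fun setT (f n)) ->
  measurable_fun setT (fun w => limn (f ^~ w)).
Proof.
move=> mf; pose A := [set w | cvgn (f ^~ w)].
have mA : measurable A.
  (* Cauchy's criterion describes convergence by countably many conditions. *)
  have -> : A = \bigcap_k \bigcup_N \bigcap_n
      [set w | ~ (k.+1%:R^-1 < `|f N w - f (N + n)%N w|)].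
    apply/seteqP; split => w /= Aw.
      move=> k _; have k0 : 0 < k.+1%:R^-1 / 2 :> R by rewrite divr_gt0.
      have /cvgrPdist_le/(_ _ k0)[N _ HN] := Aw.
      exists N => // n _ /=; apply/negP; rewrite -leNgt.
      have h1 := HN N (leqnn N); have h2 := HN (N + n)%N (leq_addr _ _).
      rewrite /= in h1 h2.
      have -> : f N w - f (N + n)%N w = (limn (f ^~ w) - f (N + n)%N w) -
        (limn (f ^~ w) - f N w) by ring.
      by rewrite (le_trans (ler_normB _ _))// [leRHS]splitr lerD.
    apply/cauchy_cvgP; apply: cauchy_exP => e e0.
    have [k ke] : exists k : nat, k.+1%:R^-1 < e.
      exists (Num.truncn e^-1); rewrite -[ltRHS]invrK ltf_pV2 ?posrE ?invr_gt0//.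
      exact: Num.Theory.truncnS_gt.
    have [N _ HN] := Aw k I.
    exists (f N w); exists N => //= n Nn.
    have := HN (n - N)%N I; rewrite /= subnKC// => /negP; rewrite -leNgt => h.
    by rewrite /ball/= (le_lt_trans h).
  apply: bigcap_measurable => [|k _]; first by exists 0%N.
  apply: bigcup_measurable => N _.
  apply: bigcap_measurable => [|n _]; first by exists 0%N.
  rewrite (_ : [set w | _] = ~` [set w | k.+1%:R^-1 < `|f N w - f (N + n)%N w|])//.
  apply: measurableC; apply: measurable_ltr_indic.
  by apply: measurableT_comp => //; exact: measurable_funB.
have mlim : measurable_fun setT (fun w => limn (f ^~ w) * \1_A w).
  apply: (measurable_fun_cvg (h := fun n w => f n w * \1_A w)).
    by move=> n; apply: measurable_funM => //; exact: measurable_indic.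
  move=> w _; rewrite indicE; case: (boolP (w \in A)) => [/set_mem Aw|_].
    by rewrite mulr1; under eq_cvg do rewrite mulr1.
  by rewrite mulr0; under eq_cvg do rewrite mulr0; exact: cvg_cst.
rewrite (_ : (fun w => _) = fun w => limn (f ^~ w) * \1_A w + (point : R) * \1_(~` A) w).
  apply: measurable_funD => //; apply: measurable_funM => //.
  by apply: measurable_indic; exact: measurableC.
apply/funext => w; rewrite !indicE in_setC.
case: (boolP (w \in A)) => [_|/negP Aw] /=; first by rewrite mulr1 mulr0 addr0.
by rewrite mulr0 add0r mulr1 dvgP// => h; apply: Aw; exact/mem_set.
Qed.

(** * The reversed series *)

Section reversed_sums.
Context (R : realType) (a : int -> R) (p : nat).
Hypothesis p_gt0 : (0 < p)%N.
Hypothesis a_periodic : forall k : int, a (k + p%:Z) = a k.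

Local Notation phi := (phi a p).
Local Notation b := (weight a p).

(** The partial sums of the series defining the law of the limit. *)
Definition reversed_sum (J : nat) (y : nat -> R) : R :=
  \sum_(1 <= r < p.+1) \sum_(0 <= k < p)
    b r * Aprod a (r%:Z - k%:Z + 1) r%:Z *
    \sum_(1 <= j < J.+1) phi ^- j * y (j * p - r + k)%N.

Lemma eq_reversed_sum (J : nat) (y y' : nat -> R) :
  (forall i, (i < J.+1 * p)%N -> y i = y' i) -> reversed_sum J y = reversed_sum J y'.
Proof.
move=> yy'; apply: eq_big_nat => r /andP[r1 rp]; apply: eq_big_nat => k /andP[_ kp].
congr (_ * _); apply: eq_big_nat => j /andP[j1 jJ]; congr (_ * _).
apply: yy'; have : (j * p <= J * p)%N by rewrite leq_mul2r; apply/orP; right.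
rewrite mulSn; lia.
Qed.

(** Reading the noise backwards turns the linearised error into a partial sum
    of the reversed series. *)
Lemma linear_errorE (X : nat -> R) (u : int -> R) (n J : nat) :
  (forall k : nat, X k.+1 = a k.+1%:Z * X k + u k.+1%:Z) -> (J <= n)%N ->
  linear_error a p X n J =
    reversed_sum J (fun i => u ((n.+1 * p)%N%:Z - i%:Z)).
Proof.
move=> X_rec Jn; rewrite /linear_error.
transitivity (\sum_(1 <= j < J.+1) \sum_(1 <= r < p.+1) \sum_(0 <= k < p)
    b r * Aprod a (r%:Z - k%:Z + 1) r%:Z *
      (phi ^- j * u ((n.+1 * p)%N%:Z - (j * p - r + k)%N%:Z))).
  apply: eq_big_nat => j /andP[j1 jJ]; rewrite big_distrr/=.
  apply: eq_big_nat => r /andP[r1 rp]; rewrite (innovationE p_gt0 a_periodic X_rec).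
  rewrite !big_distrr/=; apply: eq_big_nat => k /andP[_ kp].
  rewrite exprVn (_ : (((n - j).+1 * p + r)%N%:Z - k%:Z) =
    ((n.+1 * p)%N%:Z - (j * p - r + k)%N%:Z)); first by ring.
  have jp : (p <= j * p)%N by rewrite leq_pmull.
  have -> : (n.+1 * p = (n - j).+1 * p + j * p)%N.
    by rewrite -mulnDl; congr (_ * _)%N; lia.
  by lia.
rewrite exchange_big/=; apply: eq_bigr => r _; rewrite exchange_big/=.
by apply: eq_bigr => k _; rewrite big_distrr.
Qed.

Lemma measurable_reversed_sum d (T : measurableType d) (J : nat) (y : nat -> T -> R) :
  (forall i, measurable_fun setT (y i)) ->
  measurable_fun setT (fun w => reversed_sum J (y ^~ w)).
Proof.
move=> my; do 2 (apply: measurable_sumr => ?).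
apply: measurable_funM => //; apply: measurable_sumr => j.
exact: measurable_funM.
Qed.

End reversed_sums.

Section reversed_limit.
Context d (T : measurableType d) (R : realType) (P : probability T R).
Context (a : int -> R) (p : nat).
Hypothesis phi_gt1 : 1 < `|phi a p|.
Variable ustar : nat -> {RV P >-> R}.
Variable C : R.
Hypothesis ustarC : forall i, mean_le P (fun w => `|ustar i w|) C.

Let mustar i : measurable_fun setT (ustar i).
Proof. exact: measurable_funPT. Qed.

Lemma ae_cvg_reversed_sum : {ae P, forall w,
  reversed_sum a p J (ustar ^~ w) @[J --> \oo] --> reversed_series a p ustar w}.
Proof.
have rho01 : 0 <= `|(phi a p)^-1| < 1 by rewrite normr_ge0 rho_lt1.
have ae r k : {ae P, forall w,
    cvgn (series (fun j => `|(phi a p)^-1| ^+ j * `|ustar (j * p - r + k)%N w|))}.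
  apply: (ae_cvg_geometric_series (xi := fun j => ustar (j * p - r + k)%N) rho01).
    by move=> j; exact: mustar.
  by move=> j; case: (ustarC (j * p - r + k)%N) => _ _; exact.
have {ae} : {ae P, forall w, forall r k,
    cvgn (series (fun j => `|(phi a p)^-1| ^+ j * `|ustar (j * p - r + k)%N w|))}.
  by apply: ae_foralln => r; apply: ae_foralln => k; exact: ae.
apply: filterS => w cv.
rewrite /reversed_sum /reversed_series; apply: cvg_sumr => r; apply: cvg_sumr => k.
apply: cvgMl_tmp.
have : cvgn (series (fun j => phi a p ^- j * ustar (j * p - r + k)%N w)).
  apply: normed_cvg; have := cv r k.
  rewrite /normed_series_of/=.
  under [X in cvgn (series X)]eq_fun do rewrite -normrX exprVn -normrM.
  by [].
set xi := fun j => _ => cvxi.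
have -> : (fun J => \sum_(1 <= j < J.+1) phi a p ^- j * ustar (j * p - r + k)%N w) =
    (fun J => series xi J.+1 - xi 0%N).
  apply/funext => J; by rewrite /series/= [in RHS]big_ltn// addrAC subrr add0r.
have : cvgn (fun J => series xi J.+1 - xi 0%N).
  apply: is_cvgB; last exact: is_cvg_cst.
  by apply/cvg_ex; exists (limn (series xi)); rewrite cvg_shiftS.
by [].
Qed.

Lemma measurable_reversed_series : measurable_fun setT (reversed_series a p ustar).
Proof.
do 2 (apply: measurable_sumr => ?).
apply: measurable_funM => //; apply: measurable_limn => m.
by apply: measurable_sumr => j; apply: measurable_funM => //; exact: mustar.
Qed.

End reversed_limit.

(** * Asymptotic independence under mixing *)

Lemma cvg_half : n./2 @[n --> \oo] --> \oo.
Proof.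
move=> A [N _ NA]; exists N.*2 => //= n /= Nn; apply: NA => /=.
by lia.
Qed.

(** Test functions with values in [[0, 1]] suffice for convergence in
    distribution. *)
Lemma cvg_in_distribution_unit d (T : measurableType d) (R : realType)
    (P : probability T R) (Y : nat -> T -> R) (L : T -> R) :
  (forall n, measurable_fun setT (Y n)) -> measurable_fun setT L ->
  (forall f : R -> R, continuous f -> (forall x, 0 <= f x <= 1) ->
    \int[P]_w f (Y n w) @[n --> \oo] --> \int[P]_w f (L w)) ->
  cvg_in_distribution P Y L.
Proof.
move=> mY mL lim f cf [M0 fM0]; pose M := `|M0| + 1.
have M_gt0 : 0 < M by rewrite ltr_wpDl.
have fM x : `|f x| <= M.
  by rewrite (le_trans (fM0 x))// (le_trans (ler_norm _))// lerDl.
pose g x := (f x + M) / (2 * M).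
have g01 x : 0 <= g x <= 1.
  have := fM x; rewrite ler_norml => /andP[? ?]; rewrite /g.
  by rewrite divr_ge0//= ?ler_pdivrMr ?mul1r ?mulr_gt0//; lra.
have cg : continuous g.
  by move=> x; apply: cvgMr_tmp; apply: cvgD; [exact: cf|exact: cvg_cst].
have fE x : f x = 2 * M * g x + - M by rewrite /g; field; rewrite gt_eqF.
have intf (H : T -> R) : measurable_fun setT H -> P.-integrable setT (EFin \o (f \o H)).
  move=> mH; apply: (@integrable_bounded _ _ _ _ _ M) => [|w]; last exact: fM.
  exact: (measurable_continuous_comp cf).
have intg : forall H : T -> R, measurable_fun setT H ->
    P.-integrable setT (EFin \o (fun w => g (H w))).
  move=> H mH; apply: integrable_unit => //.
  exact: (measurable_continuous_comp cg).
have EE : forall H : T -> R, measurable_fun setT H ->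
    'E_P[f \o H]%E = (2 * M * \int[P]_w g (H w) + - M)%:E.
  move=> H mH; rewrite expectation_Rintegral; last exact: intf.
  congr (_%:E); rewrite -RintegralZl//; last exact: intg.
  have -> : - M = \int[P]_w cst (- M) w.
    by rewrite Rintegral_cst// [X in fine X]probability_setT mulr1.
  rewrite -RintegralD//.
  - by apply: eq_Rintegral => w _; rewrite /= fE.
  - apply: (@integrable_bounded _ _ _ _ _ (2 * M)).
      by apply: measurable_funM => //; exact: (measurable_continuous_comp cg).
    move=> w; have /andP[? ?] := g01 (H w).
    have M2 : 0 <= 2 * M by rewrite mulr_ge0// ltW.
    by rewrite ger0_norm; [exact: ler_piMr|exact: mulr_ge0].
  - by apply: (@integrable_bounded _ _ _ _ _ `|- M|) => [|w]; [exact: measurable_cst|].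
rewrite EE//; under eq_cvg do rewrite EE//.
apply: cvg_EFin; first exact: nearW.
apply: cvgD; last exact: cvg_cst.
by apply: cvgMl_tmp; exact: lim.
Qed.

Section mixing.
Context d (T : measurableType d) (R : realType) (P : probability T R).
Variables (X0 : {RV P >-> R}) (u : int -> {RV P >-> R}).

(** The variables generating the past up to time [k]. *)
Definition past_variables (k : int) : set (T -> R) :=
  (X0 : T -> R) |` [set (u j : T -> R) | j in [set j | j <= k]].

(** The variables generating the future from time [k] on. *)
Definition future_variables (k : int) : set (T -> R) :=
  [set (u j : T -> R) | j in [set j | k <= j]].

Lemma sigma_measurable_ler (F : set (T -> R)) (f : T -> R) (s : R) :
  sigma_measurable F f -> sigma_rv F [set w | s <= f w].
Proof.
move=> Ff; rewrite (_ : [set w | _] = f @^-1` `[s, +oo[).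
  exact: Ff.
by apply/seteqP; split => w /=; rewrite in_itv/= andbT.
Qed.

Lemma sigma_measurable_fun (F : set (T -> R)) (f : T -> R) :
  (forall g, F g -> measurable_fun setT g) ->
  sigma_measurable F f -> measurable_fun setT f.
Proof.
move=> mF Ff _ B mB; rewrite setTI.
exact: sigma_rv_measurable mF _ (Ff B mB).
Qed.

Lemma past_variables_measurable (k : int) g :
  past_variables k g -> measurable_fun setT g.
Proof. by move=> [->|[j _ <-]]; exact: measurable_funPT. Qed.

Lemma future_variables_measurable (k : int) g :
  future_variables k g -> measurable_fun setT g.
Proof. by move=> [j _ <-]; exact: measurable_funPT. Qed.

Lemma mixing_covariance_le (k m : nat) (Y G : T -> R) (e : R) :
  sigma_measurable (past_variables k%:Z) Y ->
  sigma_measurable (future_variables (k + m)%N%:Z) G ->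
  (forall w, 0 <= Y w <= 1) -> (forall w, 0 <= G w <= 1) ->
  (alpha_mixing X0 u m <= e%:E)%E ->
  `|\int[P]_w (Y w * G w) - (\int[P]_w Y w) * (\int[P]_w G w)| <= e.
Proof.
move=> sY sG Y01 G01 me.
have mY := sigma_measurable_fun (@past_variables_measurable k%:Z) sY.
have mG := sigma_measurable_fun (@future_variables_measurable (k + m)%N%:Z) sG.
apply: covariance_le => // s t.
set A := [set w | s <= Y w]; set B := [set w | t <= G w].
have mA : measurable A by exact: measurable_ler_indic.
have mB : measurable B by exact: measurable_ler_indic.
have : (`|P (A `&` B) - P A * P B| <= e%:E)%E.
  apply: le_trans me; apply: ereal_sup_ubound; exists k, A, B; split => //.
    exact: sigma_measurable_ler sY.
  exact: sigma_measurable_ler sG.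
have finP S : measurable S -> P S = (fine (P S))%:E.
  by move=> mS; rewrite fineK// fin_num_measure.
rewrite {1}(finP (A `&` B)); last exact: measurableI.
by rewrite {1}(finP A)// {1}(finP B)// -EFinM -EFinB abse_EFin lee_fin.
Qed.

(** Variables depending on an ever more remote future are asymptotically independent
    of any variable that is approximated by variables of the past. *)
Lemma mixing_asymptotic_independence (l k : nat -> nat) (G Y : nat -> T -> R)
    (K : T -> R) :
  (alpha_mixing X0 u n @[n --> \oo] --> 0)%E ->
  l n @[n --> \oo] --> \oo ->
  (forall n, sigma_measurable (future_variables (l n)%:Z) (G n)) ->
  (forall M, sigma_measurable (past_variables (k M)%:Z) (Y M)) ->
  (forall n w, 0 <= G n w <= 1) -> (forall M w, 0 <= Y M w <= 1) ->
  measurable_fun setT K -> (forall w, 0 <= K w <= 1) ->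
  {ae P, forall w, Y M w @[M --> \oo] --> K w} ->
  (\int[P]_w (G n w * K w) - (\int[P]_w G n w) * (\int[P]_w K w))
    @[n --> \oo] --> 0.
Proof.
move=> mix linf sG sY G01 Y01 mK K01 YK; apply/cvgr0Pnorm_le => e e0.
have mY M : measurable_fun setT (Y M).
  exact: sigma_measurable_fun (@past_variables_measurable (k M)%:Z) (sY M).
have mG n : measurable_fun setT (G n).
  exact: sigma_measurable_fun (@future_variables_measurable (l n)%:Z) (sG n).
have e4 : 0 < e / 4 by rewrite divr_gt0.
have dist01 (x y : R) : 0 <= x <= 1 -> 0 <= y <= 1 -> 0 <= `|x - y| <= 1.
  by move=> /andP[? ?] /andP[? ?]; rewrite normr_ge0 ler_norml; lra.
have mD M : measurable_fun setT (fun w => `|Y M w - K w|).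
  by apply: measurableT_comp => //; exact: measurable_funB.
have lim0 : \int[P]_w `|Y M w - K w| @[M --> \oo] --> 0.
  have -> : 0 = \int[P]_w (cst 0 w) :> R by rewrite Rintegral_cst// mul0r.
  apply: (@bounded_convergence _ _ _ _ _ _ 1) => //.
    by move=> M w; rewrite normr_id; have /andP[] := dist01 _ _ (Y01 M w) (K01 w).
  apply: filterS YK => w YKw /=; rewrite -(normr0 R); apply: cvg_norm.
  by rewrite -(subrr (K w)); apply: cvgB => //; exact: cvg_cst.
have /cvgr0Pnorm_le/(_ _ e4)[M _ /(_ M (leqnn M)) HM] := lim0.
have {}HM : \int[P]_w `|Y M w - K w| <= e / 4 by exact: le_trans (ler_norm _) HM.
have [m Hm] : exists m, forall n, (m <= n)%N -> (alpha_mixing X0 u n <= (e / 4)%:E)%E.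
  have : \forall n \near \oo, (alpha_mixing X0 u n < (e / 4)%:E)%E.
    by apply: (mix [set x | (x < (e / 4)%:E)%E]); apply: open_ereal_lt'; rewrite lte_fin.
  by move=> [m _ Hm]; exists m => n mn; apply/ltW; exact: Hm.
have [N _ HN] : \forall n \near \oo, (k M + m <= l n)%N.
  by apply: (linf [set x | (k M + m <= x)%N]); exists (k M + m)%N.
exists N => //= n /= Nn; have kl := HN n Nn.
have h1 : `|\int[P]_w (Y M w * G n w) - (\int[P]_w Y M w) * (\int[P]_w G n w)| <= e / 4.
  apply: (@mixing_covariance_le (k M) (l n - k M)) => //.
    by rewrite subnKC// (leq_trans _ kl)// leq_addr.
  by apply: Hm; lia.
have int1 (g : T -> R) : measurable_fun setT g -> (forall w, 0 <= g w <= 1) ->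
  P.-integrable setT (EFin \o g) by exact: integrable_unit.
have mul01 (x y : R) : 0 <= x <= 1 -> 0 <= y <= 1 -> 0 <= x * y <= 1.
  by move=> /andP[? ?] /andP[? ?]; rewrite mulr_ge0//= mulr_ile1.
have h2 : `|\int[P]_w (G n w * K w) - \int[P]_w (Y M w * G n w)| <= e / 4.
  apply: le_trans HM; apply: le_dist_Rintegral.
  - by apply: int1 => [|w]; [exact: measurable_funM|exact: mul01].
  - by apply: int1 => [|w]; [exact: measurable_funM|exact: mul01].
  - by apply: int1 => // w; exact: dist01.
  move=> w; rewrite [Y M w * _]mulrC -mulrBr normrM distrC.
  have /andP[? ?] := G01 n w; rewrite ger0_norm//.
  by rewrite ler_piMl.
have h3 : `|\int[P]_w Y M w - \int[P]_w K w| <= e / 4.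
  apply: le_trans HM; apply: le_dist_Rintegral => //; first exact: int1.
    exact: int1.
  by apply: int1 => // w; exact: dist01.
have h4 : `|(\int[P]_w Y M w) * (\int[P]_w G n w) -
    (\int[P]_w G n w) * (\int[P]_w K w)| <= e / 4.
  rewrite [X in _ - X]mulrC -mulrBl normrM (le_trans _ h3)// ler_piMr//.
  rewrite ger0_norm; first exact: Rintegral_unit_le1.
  exact: Rintegral_unit_ge0.
move: h1 h2 h4; rewrite !ler_norml; lra.
Qed.

End mixing.

(** * The least squares estimator of an explosive periodic autoregression *)

Section explosive_par.
Context d (T : measurableType d) (R : realType) (P : probability T R).
Context (p : nat) (p_gt0 : (0 < p)%N).
Context (a : int -> R) (a_periodic : forall k : int, a (k + p%:Z) = a k).
Context (u : int -> {RV P >-> R}).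
Context (u_square : forall k : int, (u k : T -> R) \in Lfun P 2%:E).
Context (u_periodic : periodically_distributed p u).
Context (X : nat -> {RV P >-> R}).
Context (X_rec : forall (k : nat) (w : T),
  X k.+1 w = a k.+1%:Z * X k w + u k.+1%:Z w).
Context (phi_gt1 : 1 < `|phi a p|).
Context (zeta : {RV P >-> R}) (zetaP : is_zeta a p u zeta).

Local Notation phi := (phi a p).
Local Notation b := (weight a p).
Local Notation Xw w := (fun k => X k w).
Local Notation W w := (X 0%N w + zeta w).

Let phi0 : phi != 0. Proof. exact: phi_neq0 phi_gt1. Qed.

Let mX k : measurable_fun setT (X k). Proof. exact: measurable_funPT. Qed.
Let mu k : measurable_fun setT (u k). Proof. exact: measurable_funPT. Qed.

Lemma ae_cvg_normalised : {ae P, forall w, forall r, (r <= p)%N ->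
  normalised a p (Xw w) r m @[m --> \oo] --> W w * b r}.
Proof.
have [C uC] := bounded_absolute_moments p_gt0 u_square u_periodic.
have rho01 : 0 <= `|phi^-1| < 1 by rewrite normr_ge0 rho_lt1.
have ae s : {ae P, forall w, (phi ^- m * u (m * p + s)%N%:Z w) @[m --> \oo] --> 0}.
  have := @ae_cvg_geometric_series _ T R P (fun m => u (m * p + s)%N%:Z) _ C rho01
    (fun m => mu _).
  move=> /(_ _)h; have {}h := h (fun m => let: And3 _ _ h := uC _ in h).
  apply: filterS h => w /cvg_series_cvg_0.
  under eq_cvg do rewrite -normrX exprVn -normrM.
  by move=> h; apply/norm_cvg0P.
have {ae} := ae_foralln ae; case: zetaP => ae_zeta _.
apply: filterS2 ae_zeta => w Zw u0 r rp.
apply: (cvg_normalised (u := fun k => u k w) p_gt0 a_periodic _ phi_gt1) => //.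
by apply: cvgD; [exact: cvg_cst|exact: Zw].
Qed.

Lemma strong_consistency : {ae P, forall w, X 0%N w + zeta w != 0 ->
  phihat p X n w @[n --> \oo] --> phi}.
Proof.
apply: filterS ae_cvg_normalised => w cx W0.
(* At a fixed [w], [phihat] is by definition [least_squares]. *)
exact: (cvg_least_squares p_gt0 phi_gt1 W0 cx).
Qed.

Let minnovation (k : nat) : measurable_fun setT (fun w => innovation a p (Xw w) k).
Proof. by apply: measurable_funB => //; exact: measurable_funM. Qed.

Let inn_w w (m r : nat) : innovation a p (Xw w) (m * p + r) =
  \sum_(0 <= k < p) Aprod a (r%:Z - k%:Z + 1) r%:Z *
    u ((m.+1 * p + r)%N%:Z - k%:Z) w.
Proof.
exact: (innovationE (u := fun k => u k w) p_gt0 a_periodic (fun k => X_rec k w)).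
Qed.

Let linear_error_w w (n J : nat) : (J <= n)%N -> linear_error a p (Xw w) n J =
  reversed_sum a p J (fun i => u ((n.+1 * p)%N%:Z - i%:Z) w).
Proof.
exact: (linear_errorE (u := fun k => u k w) p_gt0 a_periodic (fun k => X_rec k w)).
Qed.

Lemma measurable_linear_error (n J : nat) :
  measurable_fun setT (fun w => linear_error a p (Xw w) n J).
Proof.
apply: measurable_sumr => j; apply: measurable_funM => //.
by apply: measurable_sumr => r; exact: measurable_funM.
Qed.

Lemma measurable_phihat (n : nat) : measurable_fun setT (phihat p X n).
Proof.
apply: measurable_funM.
  by apply: measurable_sumr => k; exact: measurable_funM.
by apply: measurable_funV; apply: measurable_sumr => k; exact: measurable_funX.
Qed.

Lemma dominating_mean : exists C : R, forall n,
  mean_le P (fun w => dominating a p (Xw w) n) C.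
Proof.
have [C uC] := bounded_absolute_moments p_gt0 u_square u_periodic.
pose coef r k := Aprod a (r%:Z - k%:Z + 1) r%:Z.
pose Cb := \sum_(1 <= r < p.+1) \sum_(0 <= k < p) `|coef r k| * C.
have block m : mean_le P (fun w => block_size a p (Xw w) m) Cb.
  apply: mean_le_sum => r.
  rewrite (_ : (fun w => _) = fun w => `|\sum_(0 <= k < p)
      coef r k * u ((m.+1 * p + r)%N%:Z - k%:Z) w|); last first.
    by apply/funext => w; rewrite inn_w.
  apply: (mean_le_norm_sum (index_iota 0 p) (coef r)
    (f := fun k => u ((m.+1 * p + r)%N%:Z - k%:Z) : T -> R)) => k.
    exact: mu.
  exact: uC.
have Cb0 : 0 <= Cb.
  have [_ h0 h] := block 0%N; rewrite -lee_fin; apply: le_trans h.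
  by apply: integral_ge0 => w _; rewrite lee_fin.
exists (Cb / (1 - rate a p)) => n.
have [mD D0 DC] : mean_le P (fun w => dominating a p (Xw w) n)
    (\sum_(1 <= j < n.+1) rate a p ^+ j * Cb).
  apply: mean_le_sum => j; apply: mean_leZ; first by rewrite exprn_ge0// rate_ge0.
  exact: block.
split => //; apply: (le_trans DC); rewrite lee_fin -big_distrl/= mulrC ler_wpM2l//.
have rate01 : 0 <= rate a p < 1 by rewrite rate_ge0 rate_lt1.
rewrite (le_trans _ (sum_geometric_le n.+1 rate01))// [leRHS]big_ltn// expr0.
by rewrite lerDr.
Qed.

(** The linearised error has the law of a partial sum of the reversed series. *)
Lemma linear_error_law (ustar : nat -> {RV P >-> R}) (n J : nat) (g : R -> R) :
  is_reversed p (X 0%N) u ustar -> (0 < n)%N -> (J <= n)%N ->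
  continuous g -> (forall x, 0 <= g x) ->
  \int[P]_w g (linear_error a p (Xw w) n J) =
  \int[P]_w g (reversed_sum a p J (fun i => ustar i w)).
Proof.
move=> [_ rev] n0 Jn cg g0; pose N := (n.+1 * p)%N.
pose G (t : N.-tuple R) := g (reversed_sum a p J (fun i => nth 0 t i)).
have mG : measurable_fun setT G.
  apply: measurable_continuous_comp => //.
  by apply: measurable_reversed_sum => i; exact: measurable_nth_tuple.
have m1 : measurable_fun setT (fun w => [tuple ustar i w | i < N]).
  by apply: (measurable_mktuple (f := fun i => ustar i)) => i; exact: measurable_funPT.
have m2 : measurable_fun setT (fun w => [tuple u (N%:Z - i%:Z) w | i < N]).
  by apply: (measurable_mktuple (f := fun i => u (N%:Z - i%:Z))) => i; exact: mu.
have := same_law_Rintegral m1 m2 (rev n.+1 n0) mG (fun t => g0 _).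
have lt_N i : (i < J.+1 * p)%N -> (i < N)%N.
  by move=> iJ; rewrite (leq_trans iJ)// leq_mul2r ltnS Jn orbT.
have -> : \int[P]_w G [tuple ustar i w | i < N] =
    \int[P]_w g (reversed_sum a p J (fun i => ustar i w)).
  apply: eq_Rintegral => w _; congr g; apply: eq_reversed_sum => // i /lt_N iN.
  by rewrite (nth_mktuple_ord (fun i => ustar i w)).
move=> ->; apply: eq_Rintegral => w _; congr g.
rewrite (linear_error_w _ Jn).
apply: eq_reversed_sum => // i /lt_N iN.
by rewrite (nth_mktuple_ord (fun i => u (N%:Z - i%:Z) w)).
Qed.

Lemma cvg_linear_error_law (ustar : nat -> {RV P >-> R}) (zetastar : {RV P >-> R})
    (g : R -> R) :
  is_reversed p (X 0%N) u ustar ->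
  same_law P (zetastar : T -> R) (reversed_series a p ustar) ->
  continuous g -> (forall x, 0 <= g x <= 1) ->
  \int[P]_w g (linear_error a p (Xw w) n n./2) @[n --> \oo] -->
  \int[P]_w g (zetastar w).
Proof.
move=> rev law cg g01.
have g0 x : 0 <= g x by case/andP: (g01 x).
have mustar i : measurable_fun setT (ustar i) by exact: measurable_funPT.
have [C uC] := bounded_absolute_moments p_gt0 u_square u_periodic.
have ustarC i : mean_le P (fun w => `|ustar i w|) C.
  split=> //; first exact: measurableT_comp.
  have iN : (i < i.+2 * p)%N by nia.
  have [_ /(_ i.+2 isT) h] := rev.
  have := same_law_entry (f := fun i => ustar i)
    (g := fun j => u ((i.+2 * p)%N%:Z - j%:Z)) iN mustar (fun j => mu _) h.
  by move=> ->; case: (uC ((i.+2 * p)%N%:Z - i%:Z)).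
have mseries := measurable_reversed_series a p ustar.
have mg : measurable_fun setT g by exact: continuous_measurable_fun.
rewrite (same_law_Rintegral (measurable_funPT zetastar) mseries law mg g0).
have lim : \int[P]_w g (reversed_sum a p J (fun i => ustar i w)) @[J --> \oo] -->
    \int[P]_w g (reversed_series a p ustar w).
  apply: (@bounded_convergence _ _ _ _ _ _ 1).
  - move=> J; apply: measurable_continuous_comp => //.
    exact: measurable_reversed_sum.
  - exact: measurable_continuous_comp.
  - move=> n w; rewrite ger0_norm//.
    by case/andP: (g01 (reversed_sum a p n (fun i => ustar i w))).
  apply: filterS (ae_cvg_reversed_sum phi_gt1 ustarC) => w h.
  exact: (continuous_cvg _ (cg _) h).
have lim2 := cvg_comp _ _ cvg_half lim.
apply: cvg_trans lim2; apply: near_eq_cvg.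
exists 1%N => //= n /= n0; rewrite (linear_error_law rev)//.
by lia.
Qed.

(** The linearised error over the last [J] periods only involves late variables. *)
Lemma linear_error_future (n J : nat) : (J <= n)%N ->
  sigma_measurable (future_variables u ((n - J) * p)%N%:Z)
    (fun w => linear_error a p (Xw w) n J).
Proof.
move=> Jn.
under eq_fun => w do rewrite (linear_error_w _ Jn).
apply: sigma_measurable_sum => r; rewrite mem_index_iota => /andP[r1 rp].
apply: sigma_measurable_sum => k; rewrite mem_index_iota => /andP[_ kp].
apply: sigma_measurableZ.
apply: sigma_measurable_sum => j; rewrite mem_index_iota => /andP[j1 jJ].
apply: sigma_measurableZ; apply: sigma_measurable_mem.
exists ((n.+1 * p)%N%:Z - (j * p - r + k)%N%:Z) => //=.
have jp : (p <= j * p)%N by rewrite leq_pmull.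
have jJp : (j * p <= J * p)%N by rewrite leq_mul2r; apply/orP; right.
have -> : (n.+1 * p = (n - J) * p + J * p + p)%N by rewrite -mulnDl subnK// mulSn addnC.
by lia.
Qed.

(** Conversely the approximations [X_0 + Z_M] of the limit belong to the past. *)
Lemma Z_past (M : nat) :
  sigma_measurable (past_variables (X 0%N) u (M.+1 * p)%N%:Z)
    (fun w => X 0%N w + Z_ a p u M w).
Proof.
apply: sigma_measurableD; first by apply: sigma_measurable_mem; left.
apply: sigma_measurable_sum => l; rewrite mem_index_iota => /andP[_ lM].
apply: sigma_measurableZ.
apply: sigma_measurable_sum => s; rewrite mem_index_iota => /andP[_ sp].
apply: sigma_measurableZ; apply: sigma_measurable_mem; right.
exists (l * p + s)%N%:Z => //=; rewrite lez_nat mulSn addnC leq_add//.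
by rewrite leq_mul2r -ltnS lM orbT.
Qed.

(** Convergence in law of the scaled error, for test functions with values in
    [[0, 1]]. *)
Lemma asymptotic_law (ustar : nat -> {RV P >-> R}) (zetastar : {RV P >-> R})
    (f : R -> R) :
  P [set w | X 0%N w + zeta w = 0] = 0%E ->
  alpha_mixing (X 0%N) u n @[n --> \oo] --> 0%E ->
  is_reversed p (X 0%N) u ustar ->
  is_zetastar a p (X 0%N) zeta ustar zetastar ->
  continuous f -> (forall x, 0 <= f x <= 1) ->
  \int[P]_w f (phi ^+ n.+1 * (phihat p X n.+1 w - phi)) @[n --> \oo] -->
  \int[P]_w f (limit_variable a p (X 0%N) zeta zetastar w).
Proof.
move=> W0 mix rev [indep law] cf f01.
have mW : measurable_fun setT (fun w => W w) by exact: measurable_funD.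
have aeW : {ae P, forall w, W w != 0}.
  exists [set w | W w = 0]; split => //.
    rewrite (_ : [set w | _] = (fun w => W w) @^-1` [set 0])//.
    by rewrite -[X in measurable X]setTI; exact: mW.
  by move=> w /= /negP; rewrite negbK => /eqP.
pose Q w := (W w)^-1; have mQ : measurable_fun setT Q by exact: measurable_funV.
pose t n w := linear_error a p (Xw w) n n./2.
have mt n : measurable_fun setT (t n) by exact: measurable_linear_error.
pose c := limit_constant a p.
have [C domC] := dominating_mean.
pose bs := \sum_(1 <= r < p.+1) `|b r|.
have tle n w : `|t n w| <= bs * dominating a p (Xw w) n.
  by apply: linear_error_le; lia.
have bs0 : 0 <= bs by exact: sumr_ge0.
pose h s := f (c * s).
have ch : continuous h.
  move=> s; apply: (@continuous_comp _ _ _ (fun s : R => c * s) f); last exact: cf.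
  by apply: cvgMl_tmp; exact: cvg_id.
have h01 x : 0 <= h x <= 1 by exact: f01.
have mphi n : measurable_fun setT (fun w => phi ^+ n.+1 * (phihat p X n.+1 w - phi)).
  apply: measurable_funM => //; apply: measurable_funB => //.
  exact: measurable_phihat.
(* Linearisation of the error. *)
have equiv : (\int[P]_w f (phi ^+ n.+1 * (phihat p X n.+1 w - phi)) -
    \int[P]_w f (c * (t n w * Q w))) @[n --> \oo] --> 0.
  apply: (@asymptotic_equivalence _ T R P f _ _
    (fun n w => vanishing a p (Xw w) (W w) n)
    (fun n w => dominating a p (Xw w) n) C) => //.
  - by move=> n; apply: measurable_funM => //; exact: measurable_funM.
  - by move=> n; case: (domC n).
  - by move=> n w; exact: dominating_ge0.
  - by move=> n; case: (domC n).
  apply: filterS2 aeW ae_cvg_normalised => w Ww cx; split.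
  - exact: (cvg_vanishing p_gt0 phi_gt1 Ww cx).
  - exists (`|c| * (bs * `|Q w|)) => n.
    by rewrite !normrM -[leRHS]mulrA ler_wpM2l// [leRHS]mulrAC ler_wpM2r.
  - exact: (least_squares_linearisation p_gt0 phi_gt1 Ww cx).
have indepQ (g k : R -> R) : continuous g -> continuous k ->
    (forall x, 0 <= g x <= 1) -> (forall x, 0 <= k x <= 1) ->
    \int[P]_w (g (zetastar w) * k (Q w)) =
    (\int[P]_w g (zetastar w)) * (\int[P]_w k (Q w)).
  move=> cg ck g01 k01; apply/eqP; rewrite -subr_eq0 -normr_le0.
  apply: covariance_le => //.
  - exact: measurable_continuous_comp.
  - exact: measurable_continuous_comp.
  move=> s r; rewrite indep.
  - by rewrite fineM ?fin_num_measure// ?subrr ?normr0//;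
      apply: measurable_ler_indic; exact: measurable_continuous_comp.
  - apply: sigma_measurable_ler; apply: sigma_measurable_comp.
      exact: continuous_measurable_fun.
    exact: sigma_measurable_mem.
  - apply: sigma_measurable_ler; apply: (sigma_measurable_comp (g := k)).
      exact: continuous_measurable_fun.
    apply: (sigma_measurable_comp (g := fun x : R => x^-1)); first exact: measurable_inv.
    by apply: sigma_measurableD; apply: sigma_measurable_mem; [left|right].
(* The linearised error and [1 / W] are asymptotically independent. *)
have stable (g k : R -> R) : continuous g -> continuous k ->
    (forall x, 0 <= g x <= 1) -> (forall x, 0 <= k x <= 1) ->
    \int[P]_w (g (t n w) * k (Q w)) @[n --> \oo] -->
    \int[P]_w (g (zetastar w) * k (Q w)).
  move=> cg ck g01 k01; rewrite indepQ//.
  have cov := @mixing_asymptotic_independence _ T R P (X 0%N) u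
    (fun n => (n - n./2) * p)%N (fun M => M.+1 * p)%N (fun n w => g (t n w))
    (fun M w => k (X 0%N w + Z_ a p u M w)^-1) (fun w => k (Q w)) mix.
  have {}cov : (\int[P]_w (g (t n w) * k (Q w)) -
      (\int[P]_w g (t n w)) * (\int[P]_w k (Q w))) @[n --> \oo] --> 0.
    apply: cov => //.
    - move=> A [N _ NA]; exists N.*2 => //= n /= Nn; apply: NA => /=.
      by rewrite (@leq_trans (n - n./2))//; [lia|rewrite leq_pmulr].
    - move=> n; apply: sigma_measurable_comp; first exact: continuous_measurable_fun.
      by apply: linear_error_future; lia.
    - move=> M; apply: (sigma_measurable_comp (g := k)).
        exact: continuous_measurable_fun.
      apply: (sigma_measurable_comp (g := fun x : R => x^-1)); first exact: measurable_inv.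
      exact: Z_past.
    - exact: measurable_continuous_comp.
    case: zetaP => aeZ _; apply: filterS2 aeW aeZ => w Ww Zw.
    apply: (continuous_cvg _ (ck _)); apply: cvgV => //.
    by apply: cvgD; [exact: cvg_cst|exact: Zw].
  have lim : \int[P]_w g (t n w) @[n --> \oo] --> \int[P]_w g (zetastar w).
    exact: cvg_linear_error_law rev law cg g01.
  rewrite -[X in _ --> X]add0r.
  have -> : (fun n => \int[P]_w (g (t n w) * k (Q w))) = (fun n =>
      \int[P]_w (g (t n w) * k (Q w)) - (\int[P]_w g (t n w)) * (\int[P]_w k (Q w)) +
      (\int[P]_w g (t n w)) * (\int[P]_w k (Q w))).
    by apply/funext => n; rewrite subrK.
  by apply: cvgD => //; exact: cvgMr_tmp.
have tight (e : R) : 0 < e -> exists2 K : R, 0 < K &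
    forall n, \int[P]_w \1_[set w | K < `|t n w|] w <= e.
  move=> e0; have C0 : 0 <= C.
    have [_ _ hC] := domC 0%N; rewrite -lee_fin; apply: le_trans hC.
    by apply: integral_ge0 => w _; rewrite lee_fin dominating_ge0.
  have bC : 0 <= bs * C by rewrite mulr_ge0.
  exists (bs * C / e + 1); first by rewrite ltr_wpDl// divr_ge0// ltW.
  move=> n; have [m0 m1 m2] : mean_le P (fun w => `|t n w|) (bs * C).
    apply: mean_le_trans (mean_leZ bs0 (domC n)); first exact: measurableT_comp.
    by move=> w; rewrite normr_ge0 tle.
  apply: le_trans (tail_le_of_integral_le m0 _ m1 m2) _.
    by rewrite ltr_wpDl// divr_ge0// ltW.
  rewrite ler_pdivrMr; last by rewrite ltr_wpDl// divr_ge0// ltW.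
  by rewrite mulrDr mulr1 mulrCA divff ?gt_eqF// mulr1 lerDl ltW.
have lim := cvg_law_product ch h01 mt (measurable_funPT zetastar) mQ tight stable.
have -> : \int[P]_w f (limit_variable a p (X 0%N) zeta zetastar w) =
    \int[P]_w h (zetastar w * Q w).
  apply: eq_Rintegral => w _; rewrite /h /limit_variable /c /limit_constant /Q.
  congr f; rewrite invfM.
  under eq_bigr do rewrite -exprVn.
  by rewrite mulrACA; ring.
rewrite -[X in _ --> X]add0r.
have -> : (fun n => \int[P]_w f (phi ^+ n.+1 * (phihat p X n.+1 w - phi))) =
    (fun n => \int[P]_w f (phi ^+ n.+1 * (phihat p X n.+1 w - phi)) -
      \int[P]_w f (c * (t n w * Q w)) + \int[P]_w h (t n w * Q w)).
  by apply/funext => n; rewrite subrK.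
exact: cvgD.
Qed.

End explosive_par.

Theorem theorem2 (d : measure_display) (T : measurableType d) (R : realType)
  (P : probability T R)
  (p : nat) (hp : (0 < p)%N)
  (a : int -> R) (ha : forall k : int, a (k + p%:Z) = a k)
  (u : int -> {RV P >-> R})
  (hu2 : forall k : int, (u k : T -> R) \in Lfun P 2%:E)
  (hu0 : forall k : int, ('E_P[u k] = 0)%E)
  (huper : periodically_distributed p u)
  (X : nat -> {RV P >-> R})
  (hX0 : (X 0%N : T -> R) \in Lfun P 2%:E)
  (hX : forall (k : nat) (w : T),
      X k.+1 w = a k.+1%:Z * X k w + u k.+1%:Z w)
  (hphi : 1 < `|phi a p|)
  (zeta : {RV P >-> R}) (hzeta : is_zeta a p u zeta) :
  {ae P, forall w, X 0%N w + zeta w != 0 ->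
     phihat p X n w @[n --> \oo] --> phi a p} /\
  (P [set w | X 0%N w + zeta w = 0] = 0%E ->
   alpha_mixing (X 0%N) u n @[n --> \oo] --> 0%E ->
   forall ustar : nat -> {RV P >-> R}, is_reversed p (X 0%N) u ustar ->
   forall zetastar : {RV P >-> R},
     is_zetastar a p (X 0%N) zeta ustar zetastar ->
   cvg_in_distribution P
     (fun n w => phi a p ^+ n * (phihat p X n w - phi a p))
     (limit_variable a p (X 0%N) zeta zetastar)).
Proof.
split; first exact: (strong_consistency hp ha hu2 huper hX hphi hzeta).
move=> W0 mix ustar rev zetastar zs.
apply: cvg_in_distribution_unit.
- move=> n; apply: measurable_funM => //; apply: measurable_funB => //.
  exact: measurable_phihat.
- apply: measurable_funM; first exact: measurable_funM.
  apply: measurable_funV; apply: measurable_funM => //.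
  exact: measurable_funD.
move=> f cf f01; rewrite -cvg_shiftS /=.
exact: (asymptotic_law hp ha hu2 huper hX hphi hzeta W0 mix rev zs cf f01).
Qed.
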